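(* Let $(b_n)_{n\ge0}$ be a monotone sequence with $b_n>0$, $b_n\to\infty$, $b_n/b_{n-1}\to1$ and $\sum_n b_n^{-1}=\infty$, let $0<B<1$, and let $a_n=\frac{1}{2B}\sqrt{b_nb_{n-1}}$ for $n\ge1$. Then the Jacobi matrix $J$ with $(b_n)_{n\ge0}$ on the main diagonal and $(a_n)_{n\ge1}$ on the two adjacent diagonals has absolutely continuous spectrum (spectral measure), and the associated orthonormal polynomials $(p_n)$ satisfy the local uniform estimate: for every compact interval $[a,b]\subset\mathbb R$ there is a constant $C$ such that $|p_n(x)|^2\le C\,b_n^{-1}$ for all $n$ and all $x\in[a,b]$.
   Context: The orthonormal polynomials associated with $J$ are defined by $p_{-1}=0$, $p_0=1$ and the three-term recurrence $xp_n(x)=a_{n+1}p_{n+1}(x)+b_np_n(x)+a_np_{n-1}(x)$, $n\ge0$; they are orthonormal in $L^2(\mu)$ where $\mu$ is the scalar spectral measure of the self-adjoint Jacobi matrix $J$. *)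

(* Defs.v *)
From HB Require Import structures.
From mathcomp Require Import all_boot all_order all_algebra.
From mathcomp Require Import all_classical all_reals all_analysis.
Set Implicit Arguments. Unset Strict Implicit. Unset Printing Implicit Defensive.
Import Order.TTheory GRing.Theory Num.Theory.
Import numFieldNormedType.Exports.
Local Open Scope classical_set_scope.
Local Open Scope ring_scope.

(* Orthonormal polynomials of the Jacobi matrix with off-diagonal a (a n, n>=1)
   and diagonal b (b n, n>=0):  p_{-1}=0, p_0=1,
   x p_n = a_{n+1} p_{n+1} + b_n p_n + a_n p_{n-1}.
   ortho_pair a b n x = (p_{n-1}(x), p_n(x)).  (a 0 is never used, since it
   multiplies p_{-1} = 0.) *)
Fixpoint ortho_pair {R : realType} (a b : nat -> R) (n : nat) (x : R) : R * R :=
  match n with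
  | 0 => (0, 1)
  | m.+1 => let (q, r) := ortho_pair a b m x in
            (r, ((x - b m) * r - a m * q) / a m.+1)
  end.

Definition orthopoly {R : realType} (a b : nat -> R) (n : nat) (x : R) : R :=
  (ortho_pair a b n x).2.

(* a_n = (2B)^{-1} sqrt(b_n b_{n-1}) for n >= 1 (value at n = 0 irrelevant). *)
Definition jacobi_offdiag {R : realType} (B : R) (b : nat -> R) (n : nat) : R :=
  (2 * B)^-1 * Num.sqrt (b n * b n.-1).

Definition orthonormal_measure {R : realType} (a b : nat -> R)
  (mu : {measure set R -> \bar R}) : Prop :=
  forall n m : nat,
    mu.-integrable setT (fun x => (orthopoly a b n x * orthopoly a b m x)%:E) /\
    (\int[mu]_x (orthopoly a b n x * orthopoly a b m x)%:E =
       (if n == m then 1 else 0)%:E)%E.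

(* Main.v *)
(* Put [w_{n+1} = sqrt(b_n) p_n] and [w_0 = 0].  The three-term recurrence becomes
   [w_{n+2} = c_n w_{n+1} - w_n] with [c_n = 2 B (x / b_n - 1)].  Since
   [c_n -> - 2 B] lies in (-2, 2), the form
   [w_{n+1}^2 + w_n^2 - c_n w_{n+1} w_n] is eventually positive definite, and as
   [c_n] is monotone in [n] it varies by a factor of bounded product.  Hence,
   uniformly on compact sets, [w_n] is bounded (this is the estimate on [p_n]),
   [w_{n+1}^2 + w_n^2] is bounded below, and [w_n] is Lipschitz in [x] with
   constant [O(1 + s_n)], where [s_n = sum_(k < n) 1 / b_k].

   So the kernel [K_n(x, t) = sum_(k < n) p_k(x) p_k(t)] is of order [s_n] for
   [|t - x| <= eps / s_n], and by Chebyshev's inequality every measure for which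
   [p_0, ..., p_{n-1}] are orthonormal gives mass [O(1 / s_n)] to an interval of
   length [eps / s_n].  As [s_n -> oo], an orthonormal measure is locally bounded
   by a multiple of Lebesgue measure.

   For existence, the Gauss quadratures (supported on the zeros of [p_n]) obey
   the same bound; the limit of their distribution functions along an
   ultrafilter is therefore continuous, and its Stieltjes measure has the right
   integrals, the tails being controlled by the second moments of [p_j^2]. *)
Require Import Defs.
From HB Require Import structures.
From mathcomp Require Import all_boot all_order all_algebra.
From mathcomp Require Import all_classical all_reals all_analysis.
From mathcomp Require Import measurable_realfun ring lra.
From mathcomp.real_closed Require Import complex.
Set Implicit Arguments. Unset Strict Implicit. Unset Printing Implicit Defensive.
Import Order.TTheory GRing.Theory Num.Theory.
Import numFieldNormedType.Exports.
Local Open Scope classical_set_scope.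
Local Open Scope ring_scope.

(** * Energy estimates for the discrete Schroedinger equation *)

Section energy.
Variable R : realType.
Implicit Types c x y f k : R.

Definition energy c x y := x ^+ 2 + y ^+ 2 - c * x * y.

Lemma mul3_le_sqr c k x y : `|c| <= k ->
  c * x * y <= k / 2 * (x ^+ 2 + y ^+ 2).
Proof.
rewrite ler_norml => /andP[c1 c2].
have h1 : 0 <= (k - c) * (x + y) ^+ 2 by rewrite mulr_ge0 ?sqr_ge0//; lra.
have h2 : 0 <= (k + c) * (x - y) ^+ 2 by rewrite mulr_ge0 ?sqr_ge0//; lra.
nra.
Qed.

Lemma energy_ge c B x y : `|c| <= 1 + B ->
  (1 - B) / 2 * (x ^+ 2 + y ^+ 2) <= energy c x y.
Proof. by move=> /(mul3_le_sqr x y) h; rewrite /energy; lra. Qed.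

Lemma energy_le c x y : `|c| <= 2 -> energy c x y <= 2 * (x ^+ 2 + y ^+ 2).
Proof.
by rewrite -normrN => /(mul3_le_sqr x y); rewrite /energy !mulNr => h; lra.
Qed.

Lemma energy_ge0 c x y : `|c| <= 2 -> 0 <= energy c x y.
Proof.
move=> c2; have h : `|c| <= 1 + 1 by lra.
by have := energy_ge x y h; lra.
Qed.

(* [energy c] is a positive form for which [(x, y) |-> (c x - y, x)] is an
   isometry, so this is the triangle inequality. *)
Lemma sqrt_energy_step c x y f : `|c| <= 2 ->
  Num.sqrt (energy c (c * x - y + f) x) <= Num.sqrt (energy c x y) + `|f|.
Proof.
move=> c2; have D0 := energy_ge0 x y c2.
have s0 := sqrtr_ge0 (energy c x y); have f0 := normr_ge0 f.
have S : Num.sqrt (energy c x y) ^+ 2 = energy c x y by rewrite sqr_sqrtr.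
(* The quantity on the left is the derivative of [energy c] in its first argument at [c * x - y];
   its square equals [4 * energy c x y - (4 - c ^+ 2) * x ^+ 2]. *)
have g : `|2 * (c * x - y) - c * x| <= 2 * Num.sqrt (energy c x y).
  rewrite -ler_sqr ?nnegrE ?mulr_ge0// exprMn S real_normK ?num_real//.
  have : 0 <= (4 - c ^+ 2) * x ^+ 2.
    rewrite mulr_ge0 ?sqr_ge0// -[c ^+ 2]real_normK ?num_real//.
    by have := normr_ge0 c; nra.
  by rewrite /energy; lra.
have h : f * (2 * (c * x - y) - c * x) <= `|f| * (2 * Num.sqrt (energy c x y)).
  by rewrite (le_trans (ler_norm _))// normrM ler_wpM2l.
rewrite -[leRHS]ger0_norm ?addr_ge0// -sqrtr_sqr ler_wsqrtr//.
have F2 : `|f| ^+ 2 = f ^+ 2 by rewrite real_normK ?num_real.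
rewrite sqrrD S F2; move: h; rewrite /energy => h; lra.
Qed.

Lemma energy_isometry c x y : energy c (c * x - y) x = energy c x y.
Proof. by rewrite /energy; ring. Qed.

(** Changing the coefficient adds [(c - c') * x * y], and coercivity ([energy_ge]) turns this into a
    relative error. The factor [1 - B] in the hypothesis cancels the coercivity constant, so the
    relative error is exactly [e - e']. *)
Lemma energy_shift_le (B e e' c c' x y : R) : B < 1 -> `|c| <= 1 + B ->
    `|c - c'| <= (1 - B) * (e - e') ->
  0 <= e - e' /\ `|energy c' x y - energy c x y| <= (e - e') * energy c x y.
Proof.
move=> B1 c_le dc_le.
have e_ge : 0 <= e - e'.
  have B1' : 0 < 1 - B by lra.
  by rewrite -(pmulr_rge0 _ B1'); apply: le_trans dc_le.
split=> //.
have -> : energy c' x y - energy c x y = (c - c') * x * y.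
  by rewrite /energy; ring.
have h : (c - c') * x * y <= (1 - B) * (e - e') / 2 * (x ^+ 2 + y ^+ 2).
  exact: mul3_le_sqr.
have h' : - (c - c') * x * y <= (1 - B) * (e - e') / 2 * (x ^+ 2 + y ^+ 2).
  by apply: mul3_le_sqr; rewrite normrN.
have := ler_wpM2l e_ge (energy_ge x y c_le) => k.
by rewrite ler_norml; apply/andP; split; lra.
Qed.

(** The nonincreasing sequence [e] is a budget for the variation of [c]. The forcing term [f] is
    zero for a solution itself and nonzero for the difference of solutions at two values of [x]. *)
Lemma energy_growth (B : R) (e c f z : nat -> R) n :
    B < 1 -> (forall n, `|c n| <= 1 + B) ->
    (forall n, 0 <= e n <= 1 / 2) ->
    (forall n, `|c n - c n.+1| <= (1 - B) * (e n - e n.+1)) ->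
    (forall n, z n.+2 = c n * z n.+1 - z n + f n) ->
  Num.sqrt (energy (c n) (z n.+1) (z n)) <=
    2 * Num.sqrt (energy (c 0) (z 1) (z 0)) + 2 * \sum_(0 <= k < n) `|f k|.
Proof.
move=> B1 c_le e01 dc_le z_rec; pose D n := energy (c n) (z n.+1) (z n).
rewrite -/(D n) -/(D 0).
have c_le2 m : `|c m| <= 2 by have := c_le m; lra.
(* The weight [1 - e n], which stays in [[1/2, 1]], replaces the product of the factors
   [1 + (e k - e k.+1)]: one such factor times [1 - e n] is at most [1 - e n.+1]. *)
suff : Num.sqrt (D n) <= (1 - e n) *
    (2 * Num.sqrt (D 0) + 2 * \sum_(0 <= k < n) `|f k|).
  move=> /le_trans; apply; rewrite ler_piMl//; last by have := e01 n; lra.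
  by rewrite addr_ge0 ?mulr_ge0 ?sqrtr_ge0 ?sumr_ge0.
elim: n => [|n IH].
  rewrite big_nil mulr0 addr0.
  by have := e01 0; have := sqrtr_ge0 (D 0); nra.
rewrite big_nat_recr//=; set S := 2 * _ + _ in IH; set F := `|f n|.
have F0 : 0 <= F by exact: normr_ge0.
have S0 : 0 <= S by rewrite addr_ge0 ?mulr_ge0 ?sqrtr_ge0 ?sumr_ge0.
have h1 : D n.+1 <= (1 + (e n - e n.+1)) * energy (c n) (z n.+2) (z n.+1).
  have [_] := energy_shift_le (z n.+2) (z n.+1) B1 (c_le n) (dc_le n).
  by rewrite ler_norml /D; lra.
have := sqrt_energy_step (z n.+1) (z n) (f n) (c_le2 n); rewrite -z_rec => h2.
have [e_ge _] := energy_shift_le 0 0 B1 (c_le n) (dc_le n).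
set E := energy (c n) (z n.+2) _ in h1 h2.
have h3 : Num.sqrt (D n.+1) <= (1 + (e n - e n.+1)) * Num.sqrt E.
  have k1 : 1 <= 1 + (e n - e n.+1) by lra.
  have E0 : 0 <= E by exact: energy_ge0.
  rewrite -[leRHS]ger0_norm; last by rewrite mulr_ge0 ?sqrtr_ge0//; lra.
  rewrite -sqrtr_sqr ler_wsqrtr// exprMn sqr_sqrtr// (le_trans h1)//.
  rewrite ler_wpM2r// expr2; nra.
apply: le_trans h3 _.
have h4 : Num.sqrt E <= (1 - e n) * S + F by move: h2 IH; rewrite /D /F; lra.
have [/andP[en0 en1] /andP[em0 em1]] := (e01 n, e01 n.+1).
apply: (@le_trans _ _ ((1 + (e n - e n.+1)) * ((1 - e n) * S + F))).
  by rewrite ler_wpM2l//; lra.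
have k1 : (1 + (e n - e n.+1)) * (1 - e n) <= 1 - e n.+1 by nra.
have k2 : 1 + (e n - e n.+1) <= 2 * (1 - e n.+1) by lra.
have := ler_wpM2r S0 k1; have := ler_wpM2r F0 k2; rewrite /S; lra.
Qed.

(** The same weights, read from below: without forcing, [(1 - e n) * D n] is nondecreasing, where
    [D n] is the energy at step [n]. *)
Lemma energy_decay (B : R) (e c z : nat -> R) n :
    B < 1 -> (forall n, `|c n| <= 1 + B) ->
    (forall n, 0 <= e n <= 1 / 2) ->
    (forall n, `|c n - c n.+1| <= (1 - B) * (e n - e n.+1)) ->
    (forall n, z n.+2 = c n * z n.+1 - z n) ->
  energy (c 0) (z 1) (z 0) / 2 <= energy (c n) (z n.+1) (z n).
Proof.
move=> B1 c_le e01 dc_le z_rec; pose D n := energy (c n) (z n.+1) (z n).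
rewrite -/(D n) -/(D 0).
have D0 m : 0 <= D m by apply: energy_ge0; have := c_le m; lra.
suff : (1 - e 0) * D 0 <= (1 - e n) * D n.
  by have := e01 n; have := e01 0; have := D0 n; have := D0 0; nra.
elim: n => [//|n IH]; apply: le_trans IH _.
have h1 : (1 - (e n - e n.+1)) * D n <= D n.+1.
  have [_] := energy_shift_le (z n.+2) (z n.+1) B1 (c_le n) (dc_le n).
  have E : energy (c n) (z n.+2) (z n.+1) = D n.
    by rewrite z_rec energy_isometry.
  by rewrite E ler_norml -/(D n.+1); lra.
have [/andP[en0 en1] /andP[em0 em1]] := (e01 n, e01 n.+1).
have [e_ge _] := energy_shift_le 0 0 B1 (c_le n) (dc_le n).
have h2 : (1 - e n.+1) * ((1 - (e n - e n.+1)) * D n) <= (1 - e n.+1) * D n.+1.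
  by rewrite ler_wpM2l//; lra.
apply: le_trans h2; rewrite mulrA ler_wpM2r//; nra.
Qed.

End energy.

Lemma norm_le_energy (R : realType) (B c x y : R) : 0 < B -> B < 1 ->
  `|c| <= 1 + B -> `|y| <= 2 / (1 - B) * Num.sqrt (energy c x y).
Proof.
move=> B0 B1 c_le; have E0 : 0 <= energy c x y by apply: energy_ge0; lra.
have s0 := sqrtr_ge0 (energy c x y).
set L := 2 / (1 - B).
(* Coercivity gives the constant [Num.sqrt L], which is at most [L] because [1 <= L]. *)
have L1 : 1 <= L by rewrite ler_pdivlMr; lra.
have L0 : 0 <= L by lra.
rewrite -ler_sqr ?nnegrE ?(mulr_ge0 L0 s0)// exprMn sqr_sqrtr// real_normK ?num_real//.
have h := energy_ge x y c_le.
apply: (@le_trans _ _ (L * energy c x y)); last by rewrite ler_wpM2r// expr2; nra.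
have -> : y ^+ 2 = L * ((1 - B) / 2 * y ^+ 2) by rewrite /L; field; lra.
by rewrite ler_wpM2l//; have := sqr_ge0 x; nra.
Qed.

Lemma sqrt_energy_le (R : realType) (c x y : R) : `|c| <= 2 ->
  Num.sqrt (energy c x y) <= 2 * (`|x| + `|y|).
Proof.
move=> /(energy_le x y) h.
have [x0 y0] := (normr_ge0 x, normr_ge0 y).
rewrite -[leRHS]ger0_norm; last by lra.
rewrite -sqrtr_sqr ler_wsqrtr// (le_trans h)//.
by rewrite -[x ^+ 2]real_normK ?num_real// -[y ^+ 2]real_normK ?num_real//; nra.
Qed.

(** * Rescaled orthonormal polynomials and their recurrence *)

Lemma orthopolyS (R : realType) (a b : nat -> R) n x :
  orthopoly a b n.+1 x =
  ((x - b n) * orthopoly a b n x - a n * (ortho_pair a b n x).1) / a n.+1.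
Proof. by rewrite /orthopoly /=; case: (ortho_pair a b n x). Qed.

Lemma ortho_pair1 (R : realType) (a b : nat -> R) n x :
  (ortho_pair a b n.+1 x).1 = orthopoly a b n x.
Proof. by rewrite /orthopoly /=; case: (ortho_pair a b n x). Qed.

Section jacobi_solutions.
Variables (R : realType) (b : nat -> R) (B : R).
Hypothesis b_nd : forall n, b n <= b n.+1.
Hypothesis b_gt0 : forall n, 0 < b n.
Hypotheses (B0 : 0 < B) (B1 : B < 1).
Hypothesis b_oo : b @ \oo --> +oo.

Local Notation a := (jacobi_offdiag B b).
Local Notation p := (orthopoly a b).

Let B0' : 0 <= B. Proof. exact: ltW. Qed.
Let b_ge0' n : 0 <= b n. Proof. exact: ltW. Qed.

Definition coef n (x : R) := 2 * B * (x / b n - 1).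

(* The rescaling [sqrt (b n) * p n] turns the three-term recurrence into a
   discrete Schroedinger equation whose only coefficient [coef n x] is monotone
   in [n]; the index is shifted by one so that the boundary value is [w 0]. *)
Definition wsol n (x : R) := if n is m.+1 then Num.sqrt (b m) * p m x else 0.
Local Notation w := wsol.

Lemma sqrt_b_gt0 n : 0 < Num.sqrt (b n).
Proof. by rewrite sqrtr_gt0. Qed.

Lemma offdiagS n : a n.+1 = (2 * B)^-1 * (Num.sqrt (b n.+1) * Num.sqrt (b n)).
Proof. by rewrite /jacobi_offdiag sqrtrM// ltW. Qed.

Lemma offdiag_gt0 n : 0 < a n.
Proof.
rewrite /jacobi_offdiag mulr_gt0 ?invr_gt0 ?mulr_gt0//.
by rewrite sqrtr_gt0 mulr_gt0.
Qed.

(** The off-diagonal entry factors as [sqrt (b n.+1) * sqrt (b n)] up to [2 * B], so the rescaling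
    removes it from both neighbours. For [n = 0], [a 0] multiplies [p_{-1} = 0], in agreement with
    [w 0 = 0]. *)
Lemma wsol_rec n x : w n.+2 x = coef n x * w n.+1 x - w n x.
Proof.
have B0'' := B0; have sq m : b m = Num.sqrt (b m) ^+ 2.
  by rewrite sqr_sqrtr// ltW.
case: n => [|n] /=; rewrite orthopolyS /coef.
  rewrite /orthopoly /= offdiagS; have := sq 0.
  have := sqrt_b_gt0 0; have := sqrt_b_gt0 1.
  move: (Num.sqrt (b 0)) (Num.sqrt (b 1)) => s0 s1 s0_gt0 s1_gt0 ->.
  by field; rewrite !lt0r_neq0.
rewrite ortho_pair1 !offdiagS; have := sq n.+1.
have := sqrt_b_gt0 n.+2; have := sqrt_b_gt0 n.+1.
move: (Num.sqrt (b n.+1)) (Num.sqrt (b n.+2)) => s1 s2 s1_gt0 s2_gt0 ->.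
by field; rewrite !lt0r_neq0.
Qed.

Lemma b_ge0 n : b 0 <= b n.
Proof. by elim: n => // n IH; apply: le_trans IH _. Qed.

Lemma b_large (A : R) : exists N, forall n, A <= b (n + N).
Proof.
have [N _ hN] := b_oo (nbhs_pinfty_ge (num_real A)).
by exists N => n; apply: hN => /=; rewrite leq_addl.
Qed.

Lemma coef_bound (M x : R) n : `|x| <= M -> `|coef n x| <= 2 * B * (M / b 0 + 1).
Proof.
move=> xM; rewrite normrM gtr0_norm ?mulr_gt0// ler_wpM2l ?mulr_ge0//.
rewrite (le_trans (ler_normB _ _))// normr1 lerD2r normrM.
rewrite ler_pM// ?normr_ge0// normfV gtr0_norm// lef_pV2 ?posrE//.
exact: b_ge0.
Qed.

Lemma coef_shift n x t : coef n t = coef n x + 2 * B * (t - x) / b n.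
Proof. by rewrite /coef; field; rewrite lt0r_neq0. Qed.

Lemma wsol_diff n x t : w n.+2 t - w n.+2 x =
  coef n t * (w n.+1 t - w n.+1 x) - (w n t - w n x)
  + 2 * B * (t - x) / b n * w n.+1 x.
Proof. by rewrite !wsol_rec (coef_shift n x t); ring. Qed.

(** Supplies the hypotheses of the energy estimates from a rank [N] on, uniformly in [|x| <= M].
    Increments of [coef] are [2 * B * x] times increments of the monotone sequence [1 / b n], so a
    multiple of [1 / b] serves as budget. *)
Lemma tail_coef (M : R) : 0 <= M -> exists N (e : nat -> R),
  [/\ forall n, 0 <= e n <= 1 / 2,
      forall x n, `|x| <= M -> `|coef (n + N) x| <= 1 + B &
      forall x n, `|x| <= M ->
        `|coef (n + N) x - coef (n.+1 + N) x| <= (1 - B) * (e n - e n.+1)].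
Proof.
move=> M0; have B1' := B1; have B0'' := B0.
have K0 : 0 <= 2 * B * M / (1 - B) by rewrite divr_ge0 ?mulr_ge0//; lra.
(* [K] solves [K * (1 - B) = 2 * B * M], and [2 * K <= b] keeps the budget [K / b] below [1 / 2]. *)
set K := _ / _ in K0; have [N hN] := b_large (2 * K).
have e_le n : K / b (n + N) <= 1 / 2.
  by rewrite ler_pdivrMr//; have := hN n; lra.
have KE : K * (1 - B) = 2 * B * M by rewrite /K; field; lra.
exists N, (fun n => K / b (n + N)); split=> [n|x n xM|x n xM].
- by rewrite e_le divr_ge0.
- rewrite /coef mulrBr mulr1 (le_trans (ler_normB _ _))//.
  rewrite [X in _ + X]ger0_norm ?mulr_ge0//.
  suff : `|2 * B * (x / b (n + N))| <= (1 - B) / 2 by lra.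
  rewrite !normrM normfV (gtr0_norm (b_gt0 _)) (gtr0_norm B0).
  rewrite (ger0_norm (ler0n _ 2)).
  apply: (@le_trans _ _ (2 * B * (M / b (n + N)))).
    by rewrite ler_wpM2l ?mulr_ge0// ler_wpM2r ?invr_ge0.
  have -> : 2 * B * (M / b (n + N)) = (1 - B) * (K / b (n + N)).
    by rewrite mulrA -KE; ring.
  by have := e_le n; nra.
have -> : coef (n + N) x - coef (n.+1 + N) x =
    2 * B * x * ((b (n + N))^-1 - (b (n + N).+1)^-1).
  by rewrite /coef addSn; ring.
have d0 : 0 <= (b (n + N))^-1 - (b (n + N).+1)^-1.
  by rewrite subr_ge0 lef_pV2 ?posrE.
have -> : (1 - B) * (K / b (n + N) - K / b (n.+1 + N)) =
    2 * B * M * ((b (n + N))^-1 - (b (n + N).+1)^-1).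
  by rewrite -KE addSn; ring.
rewrite normrM (ger0_norm d0) ler_wpM2r// !normrM (gtr0_norm B0).
by rewrite (ger0_norm (ler0n _ 2)) ler_wpM2l// mulr_ge0 ?ltW.
Qed.

(** Covers the finitely many indices before the energy estimates apply, by a crude induction whose
    constant may grow with [n]. *)
Lemma wsol_init_bound (M : R) n : 0 <= M -> exists2 C : R, 0 <= C &
  forall (x t : R) m, (m <= n)%N -> `|x| <= M -> `|t| <= M ->
    `|w m t| <= C /\ `|w m t - w m x| <= C * `|t - x|.
Proof.
move=> M0; elim: n => [|n [C C0 IH]].
  by exists 0 => // x t [|//] _ _ _; rewrite /= subrr normr0 mul0r.
have [G G0 cG] : exists2 G : R, 0 <= G &
    forall k y, `|y| <= M -> `|coef k y| <= G.
  exists (2 * B * (M / b 0 + 1)); last by move=> k y; exact: coef_bound.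
  by rewrite mulr_ge0 ?addr_ge0 ?divr_ge0 ?mulr_ge0.
have [H HE H0] : exists2 H : R, H = 2 * B / b 0 & 0 <= H.
  by exists (2 * B / b 0); rewrite // divr_ge0 ?mulr_ge0.
have sb0 := sqrt_b_gt0 0.
have [GC HC] := (mulr_ge0 G0 C0, mulr_ge0 H0 C0).
(* [Num.sqrt (b 0)] is the value of [w 1]; [G * C + C] comes from the recurrence and [H * C] from
   the forcing term in [wsol_diff]. *)
exists (Num.sqrt (b 0) + C + G * C + C + H * C); first by lra.
set C' := _ + _.
have CC' : C <= C' by rewrite /C'; lra.
move=> x t m; rewrite leq_eqVlt => /predU1P[->|]; last first.
  rewrite ltnS => mn xM tM; have [h1 h2] := IH x t m mn xM tM.
  split; first exact: le_trans CC'.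
  by rewrite (le_trans h2)// ler_wpM2r.
case: n IH => [|n] IH xM tM.
  rewrite /w /= /orthopoly /= !mulr1 subrr normr0 gtr0_norm//.
  split; first by rewrite /C'; lra.
  by rewrite mulr_ge0 // (le_trans C0 CC').
have [h1 d1] := IH x t n.+1 (leqnn _) xM tM.
have [h1' _] := IH t x n.+1 (leqnn _) tM xM.
have [h0 d0] := IH x t n (leqnSn _) xM tM.
split.
  rewrite wsol_rec (le_trans (ler_normB _ _))// normrM.
  have : `|coef n t| * `|w n.+1 t| <= G * C by rewrite ler_pM ?cG.
  by rewrite /C'; lra.
rewrite wsol_diff (le_trans (ler_normD _ _))//.
rewrite (le_trans (lerD (ler_normB _ _) (lexx _)))//.
have k1 : `|coef n t * (w n.+1 t - w n.+1 x)| <= G * (C * `|t - x|).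
  by rewrite normrM ler_pM ?cG.
have k2 : `|2 * B * (t - x) / b n * w n.+1 x| <= H * C * `|t - x|.
  have -> : 2 * B * (t - x) / b n * w n.+1 x =
      (2 * B * (t - x)) * ((b n)^-1 * w n.+1 x) by ring.
  rewrite HE; have -> : 2 * B / b 0 * C * `|t - x| = (2 * B * `|t - x|) * ((b 0)^-1 * C).
    by ring.
  rewrite !normrM normfV (gtr0_norm B0) (gtr0_norm (b_gt0 _)).
  rewrite (ger0_norm (ler0n _ 2)) ler_wpM2l ?mulr_ge0// ler_pM ?invr_ge0//.
    by rewrite lef_pV2 ?posrE// b_ge0.
  by rewrite -normrM.
have ss : 0 <= Num.sqrt (b 0) * `|t - x| by rewrite mulr_ge0 ?sqrtr_ge0.
have cc : 0 <= C * `|t - x| by rewrite mulr_ge0.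
rewrite /C'; lra.
Qed.

End jacobi_solutions.

(** * Bounds on the rescaled solutions, uniform on compact sets *)

Section jacobi_bounds.
Variables (R : realType) (b : nat -> R) (B : R).
Hypothesis b_nd : forall n, b n <= b n.+1.
Hypothesis b_gt0 : forall n, 0 < b n.
Hypotheses (B0 : 0 < B) (B1 : B < 1).
Hypothesis b_oo : b @ \oo --> +oo.

Local Notation w := (wsol b B).
Local Notation c := (coef b B).

Definition inv_sum n := \sum_(0 <= k < n) (b k)^-1.
Local Notation s := inv_sum.

Lemma inv_sumS n : s n.+1 = s n + (b n)^-1.
Proof. by rewrite /s big_nat_recr. Qed.

Lemma inv_sum_ge0 n : 0 <= s n.
Proof. by rewrite /s sumr_ge0// => i _; rewrite invr_ge0 ltW. Qed.

Lemma inv_sum_shift N n : \sum_(0 <= k < n) (b (k + N))^-1 <= s (n + N).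
Proof.
elim: n => [|n IH]; first by rewrite big_nil inv_sum_ge0.
by rewrite big_nat_recr//= addSn inv_sumS lerD2r.
Qed.

Lemma wsol_bound (M : R) : 0 <= M -> exists2 W : R, 0 < W &
  forall n (x : R), `|x| <= M -> `|w n x| <= W.
Proof.
move=> M0; have [N [e [e01 c_le dc_le]]] := tail_coef b_nd b_gt0 B0 B1 b_oo M0.
have [C C0 wC] := wsol_init_bound b_nd b_gt0 B0 N.+1 M0.
have B1' := B1; have B0' := B0.
have L0 : 0 <= 2 / (1 - B) by rewrite divr_ge0//; lra.
have LC : 0 <= 2 / (1 - B) * (8 * C) by rewrite mulr_ge0//; lra.
(* In [8 * C], one factor 2 is from [energy_growth], one from [sqrt_energy_le], and one from the two
   initial values; the summand [C] covers the indices up to [N]. *)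
exists (2 / (1 - B) * (8 * C) + C + 1); first by lra.
move=> n x xM; have [nN|/ltnW nN] := leqP n N.
  by have [h _] := wC x x n (leqW nN) xM xM; lra.
rewrite -(subnK nN); move: (n - N)%N => k {nN n}.
have c2 : `|c (0 + N) x| <= 2 by have := c_le x 0 xM; lra.
have g := energy_growth (f := fun=> 0) (z := fun k => w (k + N) x) k B1
  (fun n => c_le x n xM) e01 (fun n => dc_le x n xM) _.
have {}g := g (fun n => esym (etrans (addr0 _) (esym (wsol_rec b_gt0 B0 (n + N) x)))).
rewrite big1 ?mulr0 ?addr0 in g; last by move=> i _; rewrite normr0.
have h := norm_le_energy (w (k.+1 + N) x) (w (k + N) x) B0 B1 (c_le x k xM).
apply: le_trans h _.
have h0 := sqrt_energy_le (w (1 + N) x) (w (0 + N) x) c2.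
have [w0 _] := wC x x N (leqnSn _) xM xM.
have [w1 _] := wC x x N.+1 (leqnn _) xM xM.
suff : 2 / (1 - B) * Num.sqrt (energy (c (k + N) x) (w (k.+1 + N) x) (w (k + N) x))
    <= 2 / (1 - B) * (8 * C) by lra.
rewrite ler_wpM2l// (le_trans g)//.
by move: h0 w0 w1; rewrite add0n add1n; lra.
Qed.

(** Energy growth for the difference of the solutions at [t] and [x]: by [wsol_diff] and
    [wsol_bound] the forcing at step [k] is at most [2 * B * W * |t - x| / b k], and these terms sum
    to a multiple of [s n]. *)
Lemma wsol_lipschitz (M : R) : 0 <= M -> exists2 C : R, 0 < C &
  forall n (x t : R), `|x| <= M -> `|t| <= M ->
    `|w n t - w n x| <= C * `|t - x| * (1 + s n).
Proof.
move=> M0; have [N [e [e01 c_le dc_le]]] := tail_coef b_nd b_gt0 B0 B1 b_oo M0.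
have [C C0 wC] := wsol_init_bound b_nd b_gt0 B0 N.+1 M0.
have [W W0 wW] := wsol_bound M0.
have B1' := B1; have B0' := B0.
have L0 : 0 <= 2 / (1 - B) by rewrite divr_ge0//; lra.
set L := 2 / (1 - B) in L0.
have LC : 0 <= L * (8 * C) by rewrite (mulr_ge0 L0)//; lra.
have LW : 0 <= L * (4 * B * W) by rewrite (mulr_ge0 L0)// !mulr_ge0// ltW.
exists (L * (8 * C) + L * (4 * B * W) + C + 1); first by lra.
move=> n x t xM tM; have d0 := normr_ge0 (t - x).
have sn := inv_sum_ge0 n.
have [nN|/ltnW nN] := leqP n N.
  have [_ h] := wC x t n (leqW nN) xM tM.
  apply: le_trans h _; set K := _ + _ + 1.
  have CK : C <= K by rewrite /K; lra.
  have K0 : 0 <= K by exact: le_trans CK.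
  apply: (@le_trans _ _ (K * `|t - x|)); first by rewrite ler_wpM2r.
  by rewrite ler_peMr ?(mulr_ge0 K0)//; lra.
move: sn; rewrite -(subnK nN); move: (n - N)%N => k {nN n} sn.
have c2 : `|c (0 + N) t| <= 2 by have := c_le t 0 tM; lra.
have g := energy_growth (z := fun k => w (k + N) t - w (k + N) x) k B1
  (fun n => c_le t n tM) e01 (fun n => dc_le t n tM)
  (fun n => wsol_diff b_gt0 B0 (n + N) x t).
have h := norm_le_energy (w (k.+1 + N) t - w (k.+1 + N) x)
  (w (k + N) t - w (k + N) x) B0 B1 (c_le t k tM).
apply: le_trans h _; rewrite -/L.
have h0 := sqrt_energy_le (w (1 + N) t - w (1 + N) x)
  (w (0 + N) t - w (0 + N) x) c2.
have [_ w0] := wC x t N (leqnSn _) xM tM.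
have [_ w1] := wC x t N.+1 (leqnn _) xM tM.
have F : \sum_(0 <= j < k) `|2 * B * (t - x) / b (j + N) * w (j + N).+1 x| <=
    2 * B * W * `|t - x| * s (k + N).
  apply: (@le_trans _ _ (2 * B * W * `|t - x| *
      \sum_(0 <= j < k) (b (j + N))^-1)); last first.
    by rewrite ler_wpM2l ?inv_sum_shift// !mulr_ge0// ltW.
  rewrite mulr_sumr ler_sum// => j _.
  rewrite [`|_ * w _ x|]normrM.
  have -> : `|2 * B * (t - x) / b (j + N)| = 2 * B * `|t - x| / b (j + N).
    rewrite !normrM normfV (gtr0_norm B0) (gtr0_norm (b_gt0 _)).
    by rewrite (ger0_norm (ler0n _ 2)).
  have -> : 2 * B * W * `|t - x| / b (j + N) =
     2 * B * `|t - x| / b (j + N) * W by ring.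
  rewrite ler_wpM2l ?wW// !mulr_ge0 ?invr_ge0//; exact: ltW.
have E : Num.sqrt (energy (c (k + N) t) (w (k.+1 + N) t - w (k.+1 + N) x)
      (w (k + N) t - w (k + N) x)) <=
    8 * C * `|t - x| + 4 * B * W * `|t - x| * s (k + N).
  by apply: le_trans g _; move: h0 w0 w1 F; rewrite add0n add1n; lra.
apply: (@le_trans _ _ (L * (8 * C * `|t - x| + 4 * B * W * `|t - x| * s (k + N)))).
  by rewrite ler_wpM2l.
have P1 := mulr_ge0 LC (mulr_ge0 d0 sn).
have P2 := mulr_ge0 LW d0.
have P3 := mulr_ge0 d0 sn.
have P4 := mulr_ge0 C0 (mulr_ge0 d0 sn).
have P5 := mulr_ge0 C0 d0.
clearbody L; lra.
Qed.

(** Beyond rank [N] the energy keeps at least half of its value there; before it, the recurrence is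
    run backwards, so two consecutive small values would force [w 1] to be small. *)
Lemma wsol_lower (M : R) : 0 <= M -> exists2 A : R, 0 < A &
  forall n (x : R), `|x| <= M -> A <= w n.+1 x ^+ 2 + w n x ^+ 2.
Proof.
move=> M0; have [N [e [e01 c_le dc_le]]] := tail_coef b_nd b_gt0 B0 B1 b_oo M0.
have B1' := B1; have B0' := B0.
have init n : exists2 A : R, 0 < A & forall m (x : R), (m <= n)%N ->
    `|x| <= M -> A <= w m.+1 x ^+ 2 + w m x ^+ 2.
  elim: n => [|n [A A0 IH]].
    exists (b 0) => // m x; rewrite leqn0 => /eqP -> _.
    by rewrite /w /= /orthopoly /= mulr1 sqr_sqrtr ?expr0n ?addr0// ltW.
  set G := 2 * B * (M / b 0 + 1).
  have G0 : 0 <= G.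
    by rewrite mulr_ge0 ?addr_ge0 ?divr_ge0 ?mulr_ge0// ltW.
  have G2 : 0 <= G ^+ 2 by rewrite sqr_ge0.
  have H0 : 0 < 3 + 2 * G ^+ 2 by clearbody G; lra.
  (* From [w n = c n * w n.+1 - w n.+2] one gets [w n ^+ 2 <= 2 * G ^+ 2 * w n.+1 ^+ 2 + 2 * w n.+2
     ^+ 2]. *)
  exists (A / (3 + 2 * G ^+ 2)); first by rewrite divr_gt0.
  move=> m x; rewrite leq_eqVlt => /predU1P[->|mn] xM; last first.
    apply: le_trans (IH m x mn xM).
    by rewrite ler_pdivrMr// ler_peMr ?(ltW A0)//; clearbody G; lra.
  rewrite ler_pdivrMr//; apply: le_trans (IH n x (leqnn _) xM) _.
  have -> : w n x = c n x * w n.+1 x - w n.+2 x.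
    by rewrite wsol_rec//; ring.
  have cG : c n x ^+ 2 <= G ^+ 2.
    rewrite -[leLHS]real_normK ?num_real// lerXn2r ?nnegrE//.
    exact: coef_bound.
  have k := ler_wpM2r (sqr_ge0 (w n.+1 x)) cG.
  have k' := mulr_ge0 G2 (sqr_ge0 (w n.+2 x)).
  have := sqr_ge0 (c n x * w n.+1 x + w n.+2 x).
  have := sqr_ge0 (w n.+1 x); have := sqr_ge0 (w n.+2 x).
  move: k k'; move: (w n.+1 x) (w n.+2 x) (c n x) => u v q.
  by clearbody G; nra.
have [A A0 hA] := init N.
have qA : 0 < (1 - B) / 8 * A by rewrite mulr_gt0//; lra.
(* The constant multiplies [(1 - B) / 2] from [energy_ge], [1 / 2] from [energy_decay] and [1 / 2]
   from [energy_le]. *)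
exists ((1 - B) / 8 * A) => // n x xM.
have [nN|/ltnW nN] := leqP n N.
  apply: le_trans (hA n x nN xM); rewrite ler_piMl ?(ltW A0)//; lra.
rewrite -(subnK nN); move: (n - N)%N => k {nN n}.
have g := energy_decay (z := fun k => w (k + N) x) k B1
  (fun n => c_le x n xM) e01 (fun n => dc_le x n xM)
  (fun n => wsol_rec b_gt0 B0 (n + N) x).
have c2 : `|c (k + N) x| <= 2 by have := c_le x k xM; lra.
have h1 := energy_le (w (k.+1 + N) x) (w (k + N) x) c2.
have h2 := energy_ge (w (1 + N) x) (w (0 + N) x) (c_le x 0 xM).
have h3 := hA N x (leqnn _) xM.
move: g h1 h2 h3; rewrite !addSn !add0n => g h1 h2 h3.
have B1'' : 0 <= (1 - B) / 2 by lra.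
have := ler_wpM2l B1'' h3; lra.
Qed.

End jacobi_bounds.

(** * The kernel and test polynomials *)

Section test_polynomials.
Variables (R : realType) (b : nat -> R) (B : R).
Hypothesis b_nd : forall n, b n <= b n.+1.
Hypothesis b_gt0 : forall n, 0 < b n.
Hypotheses (B0 : 0 < B) (B1 : B < 1).
Hypothesis b_oo : b @ \oo --> +oo.

Local Notation w := (wsol b B).
Local Notation s := (inv_sum b).
Local Notation p := (orthopoly (jacobi_offdiag B b) b).

Lemma orthopolyM_wsol n x t : p n x * p n t = w n.+1 x * w n.+1 t / b n.
Proof.
rewrite /w mulrACA -expr2 sqr_sqrtr ?(ltW (b_gt0 n))//.
by rewrite mulrAC divff ?mul1r// lt0r_neq0.
Qed.

Lemma orthopoly_sqr_le (lo hi : R) : exists C : R, forall n (x : R),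
  lo <= x <= hi -> p n x ^+ 2 <= C / b n.
Proof.
have M0 : 0 <= `|lo| + `|hi| by rewrite addr_ge0.
have [W W0 wW] := wsol_bound b_nd b_gt0 B0 B1 b_oo M0.
exists (W ^+ 2) => n x /andP[xlo xhi]; rewrite expr2 orthopolyM_wsol -expr2.
rewrite ler_wpM2r ?invr_ge0 ?(ltW (b_gt0 n))//.
rewrite -[leLHS]real_normK ?num_real// lerXn2r ?nnegrE ?(ltW W0)// wW//.
have := ler_norm hi; have := ler_norm (- lo); rewrite normrN => ? ?.
have := normr_ge0 hi; have := normr_ge0 lo => ? ?.
by rewrite ler_norml; apply/andP; split; lra.
Qed.

Lemma kernel_diag_ge (A x : R) n :
  (forall k, A <= w k.+1 x ^+ 2 + w k x ^+ 2) ->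
  A * s n <= 2 * \sum_(k < n) p k x * p k x.
Proof.
move=> wA; suff : A * s n + w n x ^+ 2 / b n <= 2 * \sum_(k < n) p k x * p k x.
  have : 0 <= w n x ^+ 2 / b n by rewrite divr_ge0 ?sqr_ge0 ?(ltW (b_gt0 n)).
  lra.
elim: n => [|n IH].
  by rewrite /s big_geq// big_ord0 /w expr0n mul0r !mulr0 addr0.
have -> : \sum_(k < n.+1) p k x * p k x =
    \sum_(k < n) p k x * p k x + w n.+1 x ^+ 2 / b n.
  by rewrite big_ord_recr expr2 -orthopolyM_wsol.
rewrite inv_sumS.
have i0 : 0 <= (b n)^-1 by rewrite invr_ge0 ltW.
have h := ler_wpM2r i0 (wA n).
have h' : w n.+1 x ^+ 2 / b n.+1 <= w n.+1 x ^+ 2 / b n.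
  by rewrite ler_wpM2l ?sqr_ge0// lef_pV2 ?posrE.
lra.
Qed.

Lemma inv_sum_le m n : (m <= n)%N -> s m <= s n.
Proof.
elim: n => [|n IH]; first by rewrite leqn0 => /eqP ->.
rewrite leq_eqVlt => /predU1P[->//|mn]; rewrite inv_sumS (le_trans (IH mn))//.
by rewrite lerDl invr_ge0 ltW.
Qed.

(* The polynomial is the kernel [sum_(k < n) p_k(x) p_k(t)], suitably scaled. *)
Lemma test_polynomial (M : R) : 0 <= M -> exists eps C : R,
  [/\ 0 < eps, 0 < C & forall n (x : R), 1 <= s n -> `|x| <= M ->
    exists2 beta : nat -> R, \sum_(k < n) beta k ^+ 2 <= C / s n &
      forall t : R, `|t| <= M -> `|t - x| <= eps / s n ->
        1 <= \sum_(k < n) beta k * p k t].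
Proof.
move=> M0.
have [W W0 wW] := wsol_bound b_nd b_gt0 B0 B1 b_oo M0.
have [A A0 wA] := wsol_lower b_nd b_gt0 B0 B1 b_oo M0.
have [L L0 wL] := wsol_lipschitz b_nd b_gt0 B0 B1 b_oo M0.
(* The kernel is at least [A / 2 * s n] on the diagonal. This window width limits its loss to
   [A / 4 * s n], so multiplying by [4 / (A * s n)] brings it above 1; the coefficients then have
   square sum at most [(4 / (A * s n)) ^+ 2 * (W ^+ 2 * s n)]. *)
exists (A / (8 * W * L)), (16 * W ^+ 2 / A ^+ 2).
have e0 : 0 < A / (8 * W * L) by rewrite divr_gt0 ?mulr_gt0.
have C0 : 0 < 16 * W ^+ 2 / A ^+ 2 by rewrite divr_gt0 ?mulr_gt0 ?exprn_gt0.
split=> // n x sn1 xM; have s0 : 0 < s n by lra.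
have Kup : \sum_(k < n) p k x ^+ 2 <= W ^+ 2 * s n.
  rewrite /s big_mkord mulr_sumr ler_sum// => k _.
  rewrite expr2 orthopolyM_wsol -expr2 ler_wpM2r ?invr_ge0 ?(ltW (b_gt0 k))//.
  by rewrite -[leLHS]real_normK ?num_real// lerXn2r ?nnegrE ?(ltW W0)// wW.
have Klow := kernel_diag_ge n (fun k => wA k x xM).
exists (fun k => 4 / (A * s n) * p k x).
  under eq_bigr do rewrite exprMn.
  rewrite -mulr_sumr; have q0 : 0 <= (4 / (A * s n)) ^+ 2 by rewrite sqr_ge0.
  apply: le_trans (ler_wpM2l q0 Kup) _.
  rewrite le_eqVlt; apply/orP; left; apply/eqP; field.
  by rewrite !lt0r_neq0.
move=> t tM tx.
have D : - (A / 4 * s n) <= \sum_(k < n) p k x * (p k t - p k x).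
  rewrite lerNl -sumrN; apply: (@le_trans _ _ (\sum_(k < n)
      (W * (L * `|t - x| * (1 + s n)) * (b k)^-1))).
    apply: ler_sum => k _; rewrite mulrBr !orthopolyM_wsol -mulrBl -mulNr.
    rewrite ler_wpM2r ?invr_ge0 ?(ltW (b_gt0 k))// -mulrBr.
    rewrite (le_trans (ler_norm _))// normrN [`|_ * _|]normrM ler_pM ?wW//.
    apply: le_trans (wL _ _ _ xM tM) _.
    by rewrite ler_wpM2l ?mulr_ge0 ?(ltW L0)// lerD2l inv_sum_le.
  rewrite -mulr_sumr -(big_mkord predT (fun k => (b k)^-1)) -/(s n).
  rewrite ler_wpM2r ?(ltW s0)//.
  have h : `|t - x| * (1 + s n) <= A / (4 * W * L).
    apply: (@le_trans _ _ (A / (8 * W * L) / s n * (2 * s n))).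
      by rewrite ler_pM//; lra.
    rewrite le_eqVlt; apply/orP; left; apply/eqP; field.
    by rewrite !lt0r_neq0.
  rewrite -!mulrA; have WL0 : 0 <= W * L by rewrite mulr_ge0 ?ltW.
  have := ler_wpM2l WL0 h; rewrite -!mulrA => /le_trans; apply.
  rewrite le_eqVlt; apply/orP; left; apply/eqP; field.
  by rewrite !lt0r_neq0.
rewrite (eq_bigr (fun k : 'I_n => 4 / (A * s n) * (p k x * p k t))); last first.
  by move=> k _; rewrite mulrA.
rewrite -mulr_sumr.
have -> : \sum_(k < n) p k x * p k t =
    \sum_(k < n) p k x * p k x + \sum_(k < n) p k x * (p k t - p k x).
  by rewrite -big_split; apply: eq_bigr => k _ /=; ring.
have As : 0 < A * s n by rewrite mulr_gt0.
rewrite mulrAC ler_pdivlMr// mul1r; lra.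
Qed.

Hypothesis s_oo : s @ \oo --> +oo.

Lemma inv_sum_large (A : R) : exists n, A <= s n.
Proof.
have [N _ hN] := s_oo (nbhs_pinfty_ge (num_real A)).
by exists N; apply: hN => /=.
Qed.

(** Cut the interval into pieces of length [eps / s n]. The full pieces contribute
    [C / eps * (y - x)] and one leftover piece contributes [C / s n], which tends to 0. The abstract
    [nu] stands both for an orthonormal measure and for the limit of the quadratures. *)
Lemma lipschitz_of_scales (nu : R -> R -> R) (M eps C : R) :
  0 < eps -> 0 < C ->
  (forall x y z, x <= y -> y <= z -> nu x z <= nu x y + nu y z) ->
  (forall n x y, 1 <= s n -> - M <= x -> x <= y -> y <= M ->
    y - x <= eps / s n -> nu x y <= C / s n) ->
  forall x y, - M <= x -> x <= y -> y <= M -> nu x y <= C / eps * (y - x).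
Proof.
move=> e0 C0 nuD nu_le x y Mx xy yM; apply/ler_addgt0Pr => d d0.
(* This size of [s n] gives both [1 <= s n] and [C / s n <= d]. *)
have [n] := inv_sum_large (1 + C / d).
have Cd : 0 < C / d by rewrite divr_gt0.
move=> sn; have sn1 : 1 <= s n by lra.
have s0 : 0 < s n by lra.
have Cs : 0 < C / s n by rewrite divr_gt0.
set h := eps / s n; have h0 : 0 < h by rewrite divr_gt0.
have step k x' : - M <= x' -> x' <= y -> y - x' <= k.+1%:R * h ->
    nu x' y <= k.+1%:R * (C / s n).
  elim: k x' => [|k IH] x' Mx' x'y; first by rewrite !mul1r; exact: nu_le.
  move=> hk; have [x'h|/ltW hx'] := leP (y - x') h.
    apply: le_trans (nu_le n _ _ sn1 Mx' x'y yM x'h) _.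
    by rewrite ler_peMl ?(ltW Cs)// ler1n.
  have y' : x' + h <= y by lra.
  have x'' : x' <= x' + h by lra.
  apply: le_trans (nuD _ _ _ x'' y') _.
  rewrite -natr1 mulrDl mul1r addrC lerD//.
    apply: IH => //; first by lra.
    by move: hk; rewrite -natr1 mulrDl mul1r; lra.
  by apply: nu_le => //; [lra|rewrite -/h; lra].
have q0 : 0 <= (y - x) / h by rewrite divr_ge0 ?(ltW h0)//; lra.
have [k1 k2] := andP (Num.Theory.truncn_itv q0).
apply: le_trans (step (Num.truncn ((y - x) / h)) x Mx xy _) _.
  by rewrite -ler_pdivrMr// ltW.
apply: (@le_trans _ _ (((y - x) / h + 1) * (C / s n))).
  by rewrite ler_wpM2r ?(ltW Cs)// -natr1 lerD2r.
have -> : ((y - x) / h + 1) * (C / s n) = C / eps * (y - x) + C / s n.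
  by rewrite /h; field; rewrite !lt0r_neq0.
rewrite lerD2l ler_pdivrMr//.
have := ler_wpM2l (ltW d0) sn.
by rewrite mulrDr mulrCA divff ?lt0r_neq0//; lra.
Qed.

End test_polynomials.

(** * Absolute continuity *)

Section absolute_continuity.
Variable R : realType.
Implicit Type mu : {measure set R -> \bar R}.

(** A Lebesgue-null set has, by the outer-measure construction, covers by half-open intervals of
    arbitrarily small total length; the Lipschitz bound transfers this smallness to [mu] on each
    bounded window. *)
Lemma lebesgue_dominates mu :
  (forall M : R, 0 <= M -> exists2 C : R, 0 <= C & forall x y : R,
     - M <= x -> x <= y -> y <= M -> (mu `]x, y]%classic <= (C * (y - x))%:E)%E) ->
  mu `<< (@lebesgue_measure R).
Proof.
move=> mu_lip; apply/null_content_dominatesP.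
suff null (A : set R) : measurable A -> lebesgue_measure A = 0%E -> mu A = 0%E.
  by move=> A mA A0; exact: null.
move=> mA A0.
pose I n : set R := `]- n%:R, n%:R]%classic.
have mI n : measurable (I n) by exact: measurable_itv.
suff h n : mu (A `&` I n) = 0%E.
  have -> : A = \bigcup_n (A `&` I n).
    by rewrite -setI_bigcupr bigcup_itvT setIT.
  apply/eqP; rewrite eq_le measure_ge0 andbT.
  apply: (@le_trans _ _ (\sum_(n <oo) mu (A `&` I n))%E).
    apply: measure_sigma_subadditive => //.
      by move=> n; apply: measurableI.
    by apply: bigcup_measurable => n _; apply: measurableI.
  by rewrite eseries0// => n _ _.
apply/eqP; rewrite eq_le measure_ge0 andbT.
have [C C0 hC] := mu_lip n%:R (ler0n _ n).
set J := I n.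
apply/lee_addgt0Pr => e e0; rewrite add0e.
have C1 : 0 < C + 1 by lra.
have : (@lebesgue_measure R A < (e / (C + 1))%:E)%E.
  by rewrite A0 lte_fin divr_gt0.
rewrite /lebesgue_measure /lebesgue_stieltjes_measure /measure_extension.
move=> /ereal_inf_lt[_ [F [mF AF] <-]] Fe.
apply: (@le_trans _ _ (\sum_(k <oo) mu (F k `&` J))%E).
  apply: measure_sigma_subadditive => //.
  - move=> k; have [x _ xF] := mF k; apply: measurableI; last exact: mI.
    by have -> : F k = `]x.1, x.2]%classic :> set R by [].
  - exact: (measurableI _ _ mA (mI n)).
  - by move=> x [Ax Jx]; have [k _ Fk] := AF x Ax; exists k.
apply: (@le_trans _ _ (\sum_(k <oo) ((C + 1)%:E * wlength idfun (F k)))%E).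
  apply: lee_nneseries => [k _ _|k _]; first exact: measure_ge0.
  have [[x1 x2] _ /= <-] := mF k.
  rewrite wlength_itv/= lte_fin; case: ifPn => x12; last first.
    by rewrite set_itv_ge ?bnd_simp// set0I measure0 mule0.
  (* Covering intervals are trimmed to the window, where the local constant [C] is valid. *)
  set c := Num.max x1 (- n%:R); set d := Num.min x2 n%:R.
  have -> : `]x1, x2]%classic `&` J = `]c, d]%classic.
    apply/seteqP; split => z; rewrite /J /I /= !in_itv/= /c /d gt_max le_min.
      by move=> [/andP[-> ->] /andP[-> ->]].
    by move=> /andP[/andP[-> ->] /andP[-> ->]].
  have [cd|dc] := leP c d; last first.
    rewrite set_itv_ge; last by rewrite bnd_simp -leNgt ltW.
    rewrite measure0 -EFinB -EFinM lee_fin mulr_ge0 ?(ltW C1)//.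
    by rewrite subr_ge0 ltW.
  apply: le_trans (hC c d _ cd _) _.
  - by rewrite /c le_max lexx orbT.
  - by rewrite /d ge_min lexx orbT.
  rewrite -EFinB -EFinM lee_fin.
  have xc : x1 <= c by rewrite /c le_max lexx.
  have dx : d <= x2 by rewrite /d ge_min lexx.
  apply: (@le_trans _ _ (C * (x2 - x1))); first by rewrite ler_wpM2l//; lra.
  by rewrite ler_wpM2r//; lra.
rewrite nneseriesZl; last first.
  by move=> k _; apply: wlength_ge0.
apply: (@le_trans _ _ ((C + 1)%:E * (e / (C + 1))%:E)%E).
  by rewrite lee_wpmul2l ?lee_fin ?(ltW C1)// ltW.
by rewrite -EFinM lee_fin mulrCA divff ?mulr1// lt0r_neq0.
Qed.

End absolute_continuity.

Section orthonormal_is_ac.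
Variables (R : realType) (a b : nat -> R) (mu : {measure set R -> \bar R}).
Hypothesis orth : orthonormal_measure a b mu.
Local Notation p := (orthopoly a b).

Lemma orthonormal_total_mass : mu setT = 1%E.
Proof.
have [_] := orth 0 0; rewrite eqxx.
under eq_integral do rewrite /orthopoly /= mulr1.
by rewrite integral_cst// mul1e.
Qed.

Lemma orthonormal_sqr_integral n (beta : nat -> R) :
  (\int[mu]_x ((\sum_(k < n) beta k * p k x) ^+ 2)%:E =
   (\sum_(k < n) beta k ^+ 2)%:E)%E /\
  mu.-integrable setT (fun x => ((\sum_(k < n) beta k * p k x) ^+ 2)%:E).
Proof.
have E x : ((\sum_(k < n) beta k * p k x) ^+ 2)%:E = (\sum_(i <- enum 'I_n)
   \sum_(j <- enum 'I_n) (beta i * beta j)%:E * (p i x * p j x)%:E)%E.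
  rewrite expr2 mulr_suml !big_enum -sumEFin; apply: eq_bigr => i _.
  rewrite mulr_sumr !big_enum -sumEFin; apply: eq_bigr => j _.
  by rewrite -EFinM; congr EFin; ring.
have I i j : mu.-integrable setT
    (fun x => (beta i * beta j)%:E * (p i x * p j x)%:E)%E.
  by apply: integrableZl => //; exact: (orth i j).1.
split; last first.
  under eq_fun do rewrite E.
  by apply: integrable_sum => // i _; apply: integrable_sum => // j _.
under eq_integral do rewrite E.
rewrite integral_sum//; last by move=> i; apply: integrable_sum.
rewrite big_enum -sumEFin; apply: eq_bigr => i _.
rewrite integral_sum//.
rewrite big_enum (bigD1 i)//= big1 ?adde0.
  rewrite integralZl//; last exact: (orth i i).1.
  by rewrite (orth i i).2 eqxx mule1 expr2.
move=> j ji; rewrite integralZl//; last exact: (orth i j).1.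
by rewrite (orth i j).2 -val_eqE eq_sym/= in ji *; rewrite (negbTE ji) mule0.
Qed.

(** Chebyshev's inequality: the squared combination dominates the indicator of [A], and
    orthonormality evaluates its integral. *)
Lemma markov_test n (beta : nat -> R) (A : set R) : measurable A ->
  (forall t, A t -> 1 <= \sum_(k < n) beta k * p k t) ->
  (mu A <= (\sum_(k < n) beta k ^+ 2)%:E)%E.
Proof.
move=> mA Q1; have [<- iQ] := orthonormal_sqr_integral n beta.
rewrite -[A in mu A]setIT -integral_indic//; apply: ge0_le_integral => //.
- by apply/measurable_EFinP; exact: measurable_indic.
- exact: measurable_int iQ.
move=> x _; rewrite lee_fin indicE; case: (boolP (x \in A)) => [|_].
  by rewrite inE => /Q1 h; rewrite expr_ge1// (le_trans ler01).
exact: sqr_ge0.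
Qed.

End orthonormal_is_ac.

Section jacobi_ac.
Variables (R : realType) (b : nat -> R) (B : R).
Hypothesis b_nd : forall n, b n <= b n.+1.
Hypothesis b_gt0 : forall n, 0 < b n.
Hypotheses (B0 : 0 < B) (B1 : B < 1).
Hypothesis b_oo : b @ \oo --> +oo.
Hypothesis s_oo : inv_sum b @ \oo --> +oo.
Local Notation a := (jacobi_offdiag B b).

Lemma jacobi_absolutely_continuous (mu : {measure set R -> \bar R}) :
  orthonormal_measure a b mu -> mu `<< (@lebesgue_measure R).
Proof.
move=> orth; apply: lebesgue_dominates => M M0.
have [eps [C [e0 C0 hQ]]] := test_polynomial b_nd b_gt0 B0 B1 b_oo M0.
have fin (A : set R) : measurable A -> mu A \is a fin_num.
  move=> mA; rewrite ge0_fin_numE//.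
  rewrite (@le_lt_trans _ _ (mu setT)) ?le_measure ?inE//.
  by rewrite (orthonormal_total_mass orth) ltry.
exists (C / eps); first by rewrite divr_ge0 ?ltW.
move=> x y Mx xy yM.
rewrite -[mu _]fineK ?fin// lee_fin.
apply: (lipschitz_of_scales s_oo (nu := fun x y => fine (mu `]x, y]%classic))
  e0 C0 _ _ Mx xy yM) => {x y Mx xy yM}.
  move=> x y z xy yz; rewrite -fineD ?fin// fine_le ?fin_numD ?fin//.
  have -> : `]x, z]%classic = `]x, y]%classic `|` `]y, z]%classic.
    by rewrite -itv_bndbnd_setU ?bnd_simp.
  exact: measureU2.
move=> n x y sn Mx xy yM xyn.
have xM : `|x| <= M by rewrite ler_norml Mx (le_trans xy).
have [beta bC bQ] := hQ n x sn xM.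
apply: le_trans bC; rewrite -lee_fin fineK ?fin//.
apply: (markov_test orth) => // t; rewrite /= in_itv/= => /andP[xt ty].
apply: bQ; first by rewrite ler_norml (le_trans Mx (ltW xt)) (le_trans ty).
by rewrite gtr0_norm ?subr_gt0//; lra.
Qed.

End jacobi_ac.

(** * Gauss quadrature *)

Section orthogonal_polynomials.
Variables (K : fieldType) (a b : nat -> K).

(** Formal polynomials over an arbitrary field, so that zeros can be sought in [R[i]] before being
    shown real. *)
Fixpoint opoly_pair n : {poly K} * {poly K} :=
  if n is m.+1 then
    let (q, r) := opoly_pair m in
    (r, (a m.+1)^-1 *: (('X - (b m)%:P) * r - a m *: q))
  else (0, 1).

Definition opoly n := (opoly_pair n).2.

Lemma opoly_pair1 n : (opoly_pair n.+1).1 = opoly n.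
Proof. by rewrite /opoly /=; case: opoly_pair. Qed.

Hypothesis a_neq0 : forall n, a n != 0.

Lemma opoly_rec n : a n.+1 *: opoly n.+1 =
  ('X - (b n)%:P) * opoly n - a n *: (opoly_pair n).1.
Proof.
rewrite /opoly /=; case: opoly_pair => q r /=.
by rewrite scalerA divff ?scale1r.
Qed.

Lemma size_opoly n : size (opoly n) = n.+1.
Proof.
suff [] : size (opoly n) = n.+1 /\ (size (opoly_pair n).1 <= n)%N by [].
elim: n => [|n [IH1 IH2]]; first by rewrite /opoly /= size_poly0 size_poly1.
rewrite opoly_pair1 IH1; split=> //.
rewrite -(size_scale _ (a_neq0 n.+1)) opoly_rec.
have r0 : opoly n != 0 by rewrite -size_poly_eq0 IH1.
have E : size (('X - (b n)%:P) * opoly n) = n.+2.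
  by rewrite size_mul ?polyXsubC_eq0// size_XsubC IH1.
rewrite size_polyDl E// size_polyN (leq_ltn_trans (size_scale_leq _ _))//.
by rewrite ltnS leqW.
Qed.

(** Only [y] is evaluated and ['X] stays formal; this makes the confluent case available by
    cancelling ['X - y%:P]. *)
Lemma christoffel_darboux n (y : K) :
  ('X - y%:P) * (\sum_(k < n) (opoly k).[y] *: opoly k) =
  a n *: ((opoly_pair n).1.[y] *: opoly n - (opoly n).[y] *: (opoly_pair n).1).
Proof.
elim: n => [|n IH].
  by rewrite big_ord0 mulr0 /opoly /= horner0 scale0r scaler0 subr0 scaler0.
have rec : (a n.+1)%:P * opoly n.+1 =
    ('X - (b n)%:P) * opoly n - (a n)%:P * (opoly_pair n).1.
  by rewrite !mul_polyC opoly_rec.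
have recy : (a n.+1) * (opoly n.+1).[y] =
    (y - b n) * (opoly n).[y] - a n * (opoly_pair n).1.[y].
  have := congr1 (horner^~ y) rec.
  by rewrite !hornerE.
rewrite big_ord_recr/= mulrDr IH opoly_pair1 -!mul_polyC.
have -> : (a n.+1)%:P * ((opoly n).[y]%:P * opoly n.+1 -
    (opoly n.+1).[y]%:P * opoly n) =
  (opoly n).[y]%:P * ((a n.+1)%:P * opoly n.+1) -
    (a n.+1 * (opoly n.+1).[y])%:P * opoly n.
  by rewrite polyCM; ring.
by rewrite rec recy polyCB !polyCM polyCB; ring.
Qed.

Lemma christoffel_darboux_root n (x y : K) :
  root (opoly n) x -> root (opoly n) y ->
  (x - y) * \sum_(k < n) (opoly k).[y] * (opoly k).[x] = 0.
Proof.
move=> /eqP px /eqP py; have := congr1 (horner^~ x) (christoffel_darboux n y).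
rewrite py scale0r subr0 hornerM hornerXsubC !hornerZ px !mulr0 => E.
apply: etrans E; congr (_ * _); rewrite horner_sum.
by apply: eq_bigr => k _; rewrite hornerZ.
Qed.

End orthogonal_polynomials.

Lemma map_opoly (K L : fieldType) (f : {rmorphism K -> L}) (a b : nat -> K) n :
  map_poly f (opoly a b n) = opoly (f \o a) (f \o b) n.
Proof.
suff : (map_poly f (opoly_pair a b n).1, map_poly f (opoly a b n)) =
   opoly_pair (f \o a) (f \o b) n by rewrite /opoly => <-.
rewrite /opoly; elim: n => [|n]; first by rewrite /= rmorph0 rmorph1.
rewrite /=; case: (opoly_pair a b n) => q r /= <-.
rewrite linearZ/= rmorphB rmorphM/= map_polyXsubC linearZ/=.
by rewrite fmorphV.
Qed.

(** * Real simple zeros and discrete orthogonality *)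

Section real_roots.
Variables (R : realType) (a b : nat -> R).
Hypothesis a_neq0 : forall n, a n != 0.
Local Notation P := (opoly a b).

Lemma horner_opoly n x : (P n).[x] = orthopoly a b n x.
Proof.
suff : ((opoly_pair a b n).1.[x], (P n).[x]) = ortho_pair a b n x.
  by rewrite /orthopoly => <-.
rewrite /opoly; elim: n => [|n]; first by rewrite /= !hornerE.
rewrite /=; case: opoly_pair => q r /= <-.
by rewrite !hornerE mulrC.
Qed.

Lemma kernel_ge1 n x : (0 < n)%N -> 1 <= \sum_(k < n) (P k).[x] * (P k).[x].
Proof.
case: n => // n _; rewrite big_ord_recl /= [P 0]/(1 : {poly R}) hornerC mulr1 lerDl.
by rewrite sumr_ge0// => i _; rewrite -expr2 sqr_ge0.
Qed.

(** Christoffel-Darboux at the roots [z] and [conjc z] gives [(z - conjc z) * sum |p_k(z)|^2 = 0],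
    and the sum is positive because [p_0 = 1]. *)
Lemma opoly_root_real n (z : R[i]) :
  root (map_poly (real_complex R) (P n)) z -> z = (complex.Re z)%:C%C.
Proof.
case: n => [|n].
  by rewrite /opoly /= rmorph1 (negbTE (root1 _)).
set f := real_complex R; rewrite map_opoly => rz.
have conjf m : map_poly (@conjc R) (opoly (f \o a) (f \o b) m) =
    opoly (f \o a) (f \o b) m.
  by rewrite map_opoly; congr opoly; apply/funext => k; exact: conjc_real.
have rz' : root (opoly (f \o a) (f \o b) n.+1) (conjc z).
  by rewrite -[X in root X]conjf; apply: rmorph_root.
have fa k : (f \o a) k != 0 by rewrite fmorph_eq0.
have := christoffel_darboux_root fa rz rz'.
have sumE : \sum_(k < n.+1) (opoly (f \o a) (f \o b) k).[conjc z] *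
    (opoly (f \o a) (f \o b) k).[z] = f (\sum_(k < n.+1)
      (complex.Re (opoly (f \o a) (f \o b) k).[z] ^+ 2 +
       complex.Im (opoly (f \o a) (f \o b) k).[z] ^+ 2)).
  rewrite [RHS](rmorph_sum (real_complex R)); apply: eq_bigr => k _.
  rewrite -{1}conjf horner_map; case: (horner _ z) => u v /=.
  by simpc; rewrite /f /real_complex_def; congr Complex; ring.
rewrite sumE => /eqP; rewrite mulf_eq0 fmorph_eq0 => /orP[|/eqP S0]; last first.
  move: S0; rewrite big_ord_recl /= [opoly _ _ 0]/(1 : {poly R[i]}) hornerC /= => S0.
  suff : 0 < (0 : R) by rewrite ltxx.
  rewrite -[X in _ < X]S0 expr1n expr0n addr0 ltr_wpDr// sumr_ge0// => i _.
  by rewrite addr_ge0 ?sqr_ge0.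
case: z {rz rz' sumE} => u v /=; rewrite subr_eq0 => /eqP[] vv.
by rewrite /real_complex_def; congr Complex; lra.
Qed.

(** Splitting over [R[i]] gives [n] real zeros with multiplicity. At a double zero [x] the
    Christoffel-Darboux identity, divided by ['X - x%:P], would make the kernel vanish at [(x, x)],
    contrary to [kernel_ge1]. *)
Lemma opoly_roots n : exists rs : seq R,
  [/\ size rs = n, uniq rs & forall x, x \in rs -> root (P n) x].
Proof.
have P0 : P n != 0 by rewrite -size_poly_eq0 size_opoly.
have [r Pr] := closed_field_poly_normal (map_poly (real_complex R) (P n)).
have lead0 : lead_coef (map_poly (real_complex R) (P n)) != 0.
  by rewrite lead_coef_eq0 map_poly_eq0.
pose rs := map (@complex.Re R) r.
have PE : P n = lead_coef (P n) *: \prod_(x <- rs) ('X - x%:P).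
  apply: (map_poly_inj (real_complex R)).
  rewrite linearZ/= {1}Pr lead_coef_map; congr (_ *: _).
  rewrite map_prod_XsubC big_map; apply: eq_big_seq => z zr.
  rewrite {1}(@opoly_root_real n z)// Pr rootZ//.
  by rewrite root_prod_XsubC.
have lP : lead_coef (P n) != 0 by rewrite lead_coef_eq0.
have rsP x : x \in rs -> root (P n) x.
  by move=> xrs; rewrite PE rootZ// root_prod_XsubC.
exists rs; split=> //.
  have := size_opoly b a_neq0 n; rewrite PE size_scale// size_prod_XsubC.
  by case.
apply: count_mem_uniq => x; case: (boolP (x \in rs)) => [xrs|/count_memPn//].
rewrite (permP (perm_to_rem xrs)) /= eqxx.
case: (boolP (x \in rem x rs)) => [xrem|/count_memPn->//].
exfalso; have n0 : (0 < n)%N.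
  have := size_opoly b a_neq0 n; rewrite PE size_scale// size_prod_XsubC.
  by case=> <-; case: (rs) xrs.
have [g gE] : exists g, P n = ('X - x%:P) * (('X - x%:P) * g).
  exists (lead_coef (P n) *: \prod_(y <- rem x (rem x rs)) ('X - y%:P)).
  rewrite {1}PE (perm_big _ (perm_to_rem xrs)) big_cons/=.
  rewrite (perm_big _ (perm_to_rem xrem)) big_cons/=.
  by rewrite -!mul_polyC; ring.
have := christoffel_darboux b a_neq0 n x.
rewrite (eqP (rsP _ xrs)) scale0r subr0 gE.
set S := \sum_(k < n) _.
have -> : a n *: ((opoly_pair a b n).1.[x] *: (('X - x%:P) * (('X - x%:P) * g))) =
  ('X - x%:P) * (a n *: ((opoly_pair a b n).1.[x] *: (('X - x%:P) * g))).
  by rewrite -!mul_polyC; ring.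
move=> /(mulfI (negbT (polyXsubC_eq0 x))) SE.
have : S.[x] = 0 by rewrite SE !hornerZ hornerM hornerXsubC subrr mul0r !mulr0.
rewrite /S horner_sum => S0; have := kernel_ge1 x n0.
under eq_bigr do rewrite -hornerZ.
by rewrite S0; lra.
Qed.

(* Discrete orthogonality: by Christoffel-Darboux the matrix [p_k(x_j)] has
   orthogonal rows, hence, once normalised, orthogonal columns. *)
Lemma gauss_quadrature n : exists q : seq (R * R),
  (forall z, z \in q -> 0 <= z.2) /\
  forall k l, (k < n)%N -> (l < n)%N ->
    \sum_(z <- q) z.2 * (orthopoly a b k z.1 * orthopoly a b l z.1) =
    (k == l)%:R.
Proof.
have [rs [rs_size rs_uniq rs_root]] := opoly_roots n.
case: n rs_size rs_root => [|n] rs_size rs_root; first by exists [::].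
pose K (x : R) := \sum_(k < n.+1) (P k).[x] * (P k).[x].
have K1 x : 1 <= K x by exact: kernel_ge1.
exists [seq (x, (K x)^-1) | x <- rs]; split.
  by move=> _ /mapP[x _ ->] /=; rewrite invr_ge0; have := K1 x; lra.
move=> k l kn ln; rewrite big_map/=.
pose x (j : 'I_n.+1) := nth 0 rs j.
have xrs j : x j \in rs by rewrite mem_nth// rs_size.
pose A : 'M[R]_n.+1 := \matrix_(j, i) (P i).[x j].
pose D : 'M[R]_n.+1 := \matrix_(j, i) ((K (x j))^-1 * (P i).[x j]).
have DA : D *m A^T = 1%:M.
  apply/matrixP => i j; rewrite !mxE.
  transitivity ((K (x i))^-1 * \sum_(m < n.+1) (P m).[x j] * (P m).[x i]).
    by rewrite mulr_sumr; apply: eq_bigr => m _; rewrite !mxE; ring.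
  have [->|ij] := eqVneq i j.
    by rewrite mulVf//; have := K1 (x j); rewrite /K => h; apply: lt0r_neq0; lra.
  have := christoffel_darboux_root a_neq0 (rs_root _ (xrs i)) (rs_root _ (xrs j)).
  move=> /eqP; rewrite mulf_eq0 subr_eq0 nth_uniq ?rs_size//.
  by rewrite -[_ == _ :> nat]/(i == j) (negbTE ij)/= => /eqP ->; rewrite mulr0.
have /matrixP/(_ (Ordinal kn) (Ordinal ln)) := mulmx1C DA.
rewrite !mxE -val_eqE/= => <-.
rewrite (big_nth 0) rs_size big_mkord; apply: eq_bigr => j _.
by rewrite !mxE !horner_opoly; ring.
Qed.

End real_roots.

(** * Generalized limits and Stieltjes measures *)

Section generalized_limit.
Variable R : realType.
Implicit Types y z : nat -> R.

(** Only eventual bounds are asked for, since the [n]-th quadrature is exact on products of [p_k]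
    and [p_l] only for [k, l < n]. *)
Definition ev_bounded y :=
  exists C N, forall n, (N <= n)%N -> `|y n| <= C.

(** The image ultrafilter lives on a compact segment, hence clusters there, and an ultrafilter
    converges to its cluster points. *)
Lemma ultra_cvg (U : set_system nat) y : UltraFilter U -> \oo `<=` U ->
  ev_bounded y -> cvg (y n @[n --> U]).
Proof.
move=> UU oU [C [N yC]].
have PU : ProperFilter U by apply: ultra_proper.
have UC : (y @ U) `[- C, C]%classic.
  apply: oU; exists N => // n /= Nn.
  by rewrite in_itv/= -ler_norml yC.
have [p [_ cp]] := @segment_compact R (- C) C _ _ UC.
apply/cvg_ex; exists p => B pB.
have [//|UB] := in_ultra_setVsetC (y @^-1` B) UU.
by have [? [? ?]] := cp _ _ (UB : (y @ U) (~` B)) pB.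
Qed.

(* The limit along a free ultrafilter. *)
Lemma generalized_limit_exists : exists L : (nat -> R) -> R,
  [/\ forall y z N, ev_bounded y -> ev_bounded z ->
        (forall n, (N <= n)%N -> y n <= z n) -> L y <= L z,
      forall y z, ev_bounded y -> ev_bounded z ->
        L (fun n => y n + z n) = L y + L z,
      forall c y, ev_bounded y -> L (fun n => c * y n) = c * L y &
      forall c, L (fun=> c) = c].
Proof.
have [U [UU oU]] := @ultraFilterLemma nat \oo _.
have PU : ProperFilter U by apply: ultra_proper.
exists (fun y => lim (y n @[n --> U])); split.
- move=> y z N by_ bz yz; apply: ler_lim; [exact: ultra_cvg..|].
  by apply: oU; exists N.
- by move=> y z by_ bz; apply: limD; exact: ultra_cvg.
- move=> c y by_; apply/cvg_lim => //.
  by apply: cvgM; [exact: cvg_cst|exact: ultra_cvg].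
- by move=> c; apply: lim_cst.
Qed.

End generalized_limit.

Section stieltjes.
Variables (R : realType) (F : R -> R).
Hypotheses (F_nd : {homo F : x y / x <= y})
           (F_rc : forall x, F y @[y --> x^'+] --> F x).

HB.instance Definition _ := isCumulative.Build R _ R F F_nd F_rc.

(* [lebesgue_stieltjes_measure F] lives on a copy of [R] with another display. *)
Definition stieltjes (A : set R) : \bar R := lebesgue_stieltjes_measure F A.

Let stieltjes0 : stieltjes set0 = 0%E.
Proof. exact: (measure0 (lebesgue_stieltjes_measure F)). Qed.

Let stieltjes_ge0 A : (0 <= stieltjes A)%E.
Proof. exact: (measure_ge0 (lebesgue_stieltjes_measure F)). Qed.

Let stieltjes_additive : semi_sigma_additive stieltjes.
Proof.
exact: (@measure_semi_sigma_additive _ _ _ (lebesgue_stieltjes_measure F)).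
Qed.

HB.instance Definition _ := isMeasure.Build _ R R stieltjes
  stieltjes0 stieltjes_ge0 stieltjes_additive.

Lemma stieltjes_measure_exists : exists mu : {measure set R -> \bar R},
  forall x y, x <= y -> mu `]x, y]%classic = (F y - F x)%:E.
Proof.
exists stieltjes => x y xy.
rewrite /= /stieltjes /lebesgue_stieltjes_measure.
rewrite /measure_extension measurable_mu_extE/=; last exact: is_ocitv.
by rewrite wlength_itv_bnd.
Qed.

End stieltjes.

(** Each bisection halves the quadratic bound, so [2 ^+ k * g x y <= A * (y - x) ^+ 2] for every
    [k]. It serves to identify two additive interval functions that agree to second order. *)
Lemma subadditive_quadratic_le0 (R : realType) (g : R -> R -> R) (l r A : R) :
  (forall x y z, l <= x -> x <= y -> y <= z -> z <= r ->
     g x z <= g x y + g y z) ->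
  (forall x y, l <= x -> x <= y -> y <= r -> g x y <= A * (y - x) ^+ 2) ->
  forall x y, l <= x -> x <= y -> y <= r -> g x y <= 0.
Proof.
move=> gD gA.
have half k x y : l <= x -> x <= y -> y <= r ->
    2 ^+ k * g x y <= A * (y - x) ^+ 2.
  elim: k x y => [|k IH] x y lx xy yr; first by rewrite mul1r gA.
  have xm : x <= (x + y) / 2 by lra.
  have my : (x + y) / 2 <= y by lra.
  have h1 := IH _ _ lx xm (le_trans my yr).
  have h2 := IH _ _ (le_trans lx xm) my yr.
  have k0 : 0 <= 2 ^+ k.+1 :> R by rewrite exprn_ge0.
  have := ler_wpM2l k0 (gD _ _ _ lx xm my yr).
  by rewrite exprS; lra.
move=> x y lx xy yr; rewrite leNgt; apply/negP => g0.
have [k kE] : exists k, A * (y - x) ^+ 2 < k%:R * g x y.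
  exists (Num.truncn (A * (y - x) ^+ 2 / g x y)).+1.
  by rewrite -ltr_pdivrMr// truncnS_gt.
have := half k x y lx xy yr.
have : k%:R * g x y <= 2 ^+ k * g x y.
  by rewrite ler_wpM2r ?(ltW g0)// -natrX ler_nat ltnW// ltn_expl.
lra.
Qed.

(** * Existence of an orthonormal measure *)

Lemma measurable_orthopoly (R : realType) (a b : nat -> R) n :
  measurable_fun setT (orthopoly a b n).
Proof.
suff [_ //] : measurable_fun setT (fun x => (ortho_pair a b n x).1) /\
  measurable_fun setT (orthopoly a b n).
elim: n => [|n [m1 m2]]; first by split; exact: measurable_cst.
split.
  by rewrite (_ : (fun x => _) = orthopoly a b n)//; apply/funext => x;
    exact: ortho_pair1.
rewrite (_ : orthopoly _ _ _ = (fun x => ((x - b n) * orthopoly a b n x -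
    a n * (ortho_pair a b n x).1) * (a n.+1)^-1)); last first.
  by apply/funext => x; exact: orthopolyS.
apply: measurable_funM; last exact: measurable_cst.
apply: measurable_funB; apply: measurable_funM => //.
by apply: measurable_funB => //; exact: measurable_id.
Qed.

Section limit_measure.
Variables (R : realType) (b : nat -> R) (B : R).
Hypothesis b_nd : forall n, b n <= b n.+1.
Hypothesis b_gt0 : forall n, 0 < b n.
Hypotheses (B0 : 0 < B) (B1 : B < 1).
Hypothesis b_oo : b @ \oo --> +oo.
Hypothesis s_oo : inv_sum b @ \oo --> +oo.
Local Notation a := (jacobi_offdiag B b).
Local Notation p := (orthopoly a b).

Variable q : nat -> seq (R * R).
Hypothesis q_ge0 : forall n z, z \in q n -> 0 <= z.2.
Hypothesis q_orth : forall n k l, (k < n)%N -> (l < n)%N ->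
  \sum_(z <- q n) z.2 * (p k z.1 * p l z.1) = (k == l)%:R.

Variable L : (nat -> R) -> R.
Hypothesis L_le : forall y z N, ev_bounded y -> ev_bounded z ->
  (forall n, (N <= n)%N -> y n <= z n) -> L y <= L z.
Hypothesis LD : forall y z, ev_bounded y -> ev_bounded z ->
  L (fun n => y n + z n) = L y + L z.
Hypothesis LZ : forall c y, ev_bounded y -> L (fun n => c * y n) = c * L y.
Hypothesis L_cst : forall c, L (fun=> c) = c.

Implicit Types f g : R -> R.

Definition quad n f := \sum_(z <- q n) z.2 * f z.1.
Local Notation E := quad.

Lemma quad_le n f g : (forall x, f x <= g x) -> E n f <= E n g.
Proof.
move=> fg; rewrite /quad big_seq [leRHS]big_seq.
by apply: ler_sum => z zq; rewrite ler_wpM2l ?(q_ge0 zq).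
Qed.

Lemma quadD n f g : E n (fun x => f x + g x) = E n f + E n g.
Proof.
by rewrite /quad -big_split; apply: eq_bigr => z _; rewrite mulrDr.
Qed.

Lemma quadZ n c f : E n (fun x => c * f x) = c * E n f.
Proof. by rewrite /quad mulr_sumr; apply: eq_bigr => z _; rewrite mulrCA. Qed.

Lemma quad_cst n c : (0 < n)%N -> E n (fun=> c) = c.
Proof.
move=> n0; have E1 : E n (fun x => p 0 x * p 0 x) = 1 := q_orth n0 n0.
transitivity (c * E n (fun x => p 0 x * p 0 x)); last by rewrite E1 mulr1.
by rewrite -quadZ; apply: eq_bigr => z _; rewrite /orthopoly /= !mulr1.
Qed.

Lemma quad_orth n k l : (k < n)%N -> (l < n)%N ->
  E n (fun x => p k x * p l x) = (k == l)%:R.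
Proof. exact: q_orth. Qed.

Lemma quad_bounded_by f g : (forall x, `|f x| <= g x) ->
  ev_bounded (E^~ g) -> ev_bounded (E^~ f).
Proof.
move=> fg [C [N gC]]; exists C, N => n Nn; apply: le_trans (gC n Nn).
apply: le_trans (ler_norm _); rewrite ler_norml; apply/andP; split.
  rewrite -mulN1r -quadZ; apply: quad_le => x; rewrite mulN1r.
  by have := fg x; rewrite ler_norml => /andP[].
by apply: quad_le => x; exact: le_trans (ler_norm _) (fg x).
Qed.

Lemma quad_bounded_cst c : ev_bounded (E^~ (fun=> c)).
Proof. by exists `|c|, 1 => n n0; rewrite quad_cst. Qed.

Definition Lim f := L (E^~ f).

Lemma Lim_le f g : ev_bounded (E^~ f) -> ev_bounded (E^~ g) ->
  (forall x, f x <= g x) -> Lim f <= Lim g.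
Proof.
by move=> fb gb fg; apply: (L_le (N := 0)) => // n _; exact: quad_le.
Qed.

Lemma LimD f g : ev_bounded (E^~ f) -> ev_bounded (E^~ g) ->
  Lim (fun x => f x + g x) = Lim f + Lim g.
Proof.
by move=> fb gb; rewrite -LD//; congr L; apply/funext => n; exact: quadD.
Qed.

Lemma LimZ c f : ev_bounded (E^~ f) -> Lim (fun x => c * f x) = c * Lim f.
Proof.
by move=> fb; rewrite -LZ//; congr L; apply/funext => n; exact: quadZ.
Qed.

Lemma L_ev_cst (y : nat -> R) c N : (forall n, (N <= n)%N -> y n = c) -> L y = c.
Proof.
move=> yc; have by_ : ev_bounded y by exists `|c|, N => n /yc ->.
have bc : ev_bounded (fun=> c) by exists `|c|, 0.
apply/eqP; rewrite -[X in _ == X](L_cst c) eq_le; apply/andP.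
by split; apply: (L_le (N := N)) => // n /yc ->.
Qed.

Definition oc_ind (x y t : R) : R := (x < t <= y)%R%:R.

Lemma oc_ind_split x y z t : x <= y -> y <= z ->
  oc_ind x z t = oc_ind x y t + oc_ind y z t.
Proof.
move=> xy yz; rewrite /oc_ind; case: (leP t y) => ty /=.
  by rewrite addr0 (le_trans ty yz).
by rewrite andbF add0r (le_lt_trans xy ty).
Qed.

Lemma oc_ind_itv x y t : 0 <= oc_ind x y t <= 1.
Proof. by rewrite /oc_ind; case: (x < t <= y); rewrite /= ?ler01 ?lexx. Qed.

Lemma oc_ind_bounded x y : ev_bounded (E^~ (oc_ind x y)).
Proof.
apply: (@quad_bounded_by _ (fun=> 1)); last exact: quad_bounded_cst.
by move=> t; have /andP[h0 h1] := oc_ind_itv x y t; rewrite ger0_norm.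
Qed.

Definition nu x y := Lim (oc_ind x y).

Lemma nu_ge0 x y : 0 <= nu x y.
Proof.
rewrite -[0](@L_ev_cst (E^~ (fun=> 0)) 0 1); last by move=> n; exact: quad_cst.
apply: Lim_le; [exact: quad_bounded_cst|exact: oc_ind_bounded|].
by move=> t; have /andP[] := oc_ind_itv x y t.
Qed.

Lemma nuD x y z : x <= y -> y <= z -> nu x z = nu x y + nu y z.
Proof.
move=> xy yz; rewrite /nu -LimD; [|exact: oc_ind_bounded..].
by congr Lim; apply/funext => t; exact: oc_ind_split.
Qed.

Lemma quad_sqr n m (beta : nat -> R) : (m <= n)%N ->
  E n (fun x => (\sum_(k < m) beta k * p k x) ^+ 2) = \sum_(k < m) beta k ^+ 2.
Proof.
move=> mn; rewrite /quad.
transitivity (\sum_(z <- q n) \sum_(k < m) \sum_(l < m)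
    beta k * beta l * (z.2 * (p k z.1 * p l z.1))).
  apply: eq_bigr => z _; rewrite expr2 mulr_suml mulr_sumr.
  apply: eq_bigr => k _; rewrite mulr_sumr mulr_sumr.
  by apply: eq_bigr => l _; ring.
rewrite exchange_big; apply: eq_bigr => k _.
rewrite exchange_big (bigD1 k)//= -mulr_sumr q_orth ?(leq_trans (ltn_ord _))//.
rewrite eqxx mulr1 big1 ?addr0// => l lk.
rewrite -mulr_sumr q_orth ?(leq_trans (ltn_ord _))//.
by rewrite eq_sym -[_ == _ :> nat]/(l == k) (negbTE lk) mulr0.
Qed.

Lemma nu_lipschitz (M : R) : 0 <= M -> exists2 C : R, 0 <= C &
  forall x y : R, - M <= x -> x <= y -> y <= M -> nu x y <= C * (y - x).
Proof.
move=> M0; have [eps [C [e0 C0 hQ]]] := test_polynomial b_nd b_gt0 B0 B1 b_oo M0.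
exists (C / eps); first by rewrite divr_ge0 ?ltW.
move=> x y Mx xy yM.
apply: (lipschitz_of_scales s_oo (nu := nu) e0 C0 _ _ Mx xy yM)
  => {x y Mx xy yM}; first by move=> x y z xy yz; rewrite (nuD xy yz).
move=> m x y sm Mx xy yM xym.
have xM : `|x| <= M by rewrite ler_norml Mx (le_trans xy).
have [beta bC bQ] := hQ m x sm xM.
apply: le_trans bC.
rewrite -[leRHS](@L_cst (\sum_(k < m) beta k ^+ 2)).
(* For [m <= n] the quadrature integrates the squared test polynomial exactly, so the Chebyshev
   bound passes to the limit. *)
apply: (L_le (N := m)); [exact: oc_ind_bounded| |].
  by exists `|\sum_(k < m) beta k ^+ 2|, 0.
move=> n mn; rewrite -(quad_sqr beta mn); apply: quad_le => t.
rewrite /oc_ind; have [/andP[xt ty]|_] := boolP (x < t <= y); last exact: sqr_ge0.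
rewrite expr_ge1// ?(le_trans ler01)//.
  apply: bQ; first by rewrite ler_norml (le_trans Mx (ltW xt)) (le_trans ty).
  by rewrite gtr0_norm ?subr_gt0//; lra.
apply: bQ; first by rewrite ler_norml (le_trans Mx (ltW xt)) (le_trans ty).
by rewrite gtr0_norm ?subr_gt0//; lra.
Qed.

Definition limit_cdf x := Lim (fun t => (t <= x)%R%:R).

Lemma limit_cdfB x y : x <= y -> limit_cdf y - limit_cdf x = nu x y.
Proof.
move=> xy; suff -> : limit_cdf y = limit_cdf x + nu x y by rewrite addrC addKr.
rewrite /limit_cdf /nu -LimD; last exact: oc_ind_bounded.
  congr Lim; apply/funext => t; rewrite /oc_ind; case: (leP t x) => tx /=.
    by rewrite (le_trans tx xy) addr0.
  by rewrite add0r.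
apply: (@quad_bounded_by _ (fun=> 1)); last exact: quad_bounded_cst.
by move=> t; case: (t <= x); rewrite ?normr1// normr0.
Qed.

Lemma limit_cdf_nd : {homo limit_cdf : x y / x <= y}.
Proof. by move=> x y xy; rewrite -subr_ge0 limit_cdfB// nu_ge0. Qed.

Lemma limit_cdf_right_continuous x : limit_cdf y @[y --> x^'+] --> limit_cdf x.
Proof.
have M0 : 0 <= `|x| + 1 by rewrite addr_ge0.
have [C C0 hC] := nu_lipschitz M0.
apply/cvgrPdist_le => e e0; near=> y.
have xy : x < y by near: y; exact: nbhs_right_gt.
have yx1 : y - x < 1.
  by rewrite ltrBlDr addrC; near: y; apply: nbhs_right_lt; rewrite ltrDl.
have yxe : y - x <= e / (C + 1).
  rewrite lerBlDr addrC; near: y; apply: nbhs_right_le.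
  by rewrite ltrDl divr_gt0//; lra.
rewrite distrC limit_cdfB ?(ltW xy)// ger0_norm ?nu_ge0//.
have xn := ler_norm x; have xn' := ler_norm (- x); rewrite normrN in xn'.
apply: le_trans (hC x y _ (ltW xy) _) _; [lra|lra|].
have C1 : 0 < C + 1 by lra.
have := yxe; rewrite ler_pdivlMr// => h; nra.
Unshelve. all: by end_near. Qed.

Variable mu : {measure set R -> \bar R}.
Hypothesis mu_itv : forall x y, x <= y -> mu `]x, y]%classic = (nu x y)%:E.

(** * Integrals of locally Lipschitz functions over bounded intervals *)

Section local_integral.
Variables (f : R -> R) (M K : R).
Hypotheses (M0 : 0 <= M) (K0 : 0 <= K).
Hypothesis f_ge0 : forall x, 0 <= f x.
Hypothesis mf : measurable_fun setT f.
Hypothesis fb : ev_bounded (E^~ f).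
Hypothesis f_lip : forall x y, `|x| <= M -> `|y| <= M ->
  `|f x - f y| <= K * `|x - y|.

Let fi x y := fun t => f t * oc_ind x y t.

Let fi_bounded x y : ev_bounded (E^~ (fi x y)).
Proof.
apply: quad_bounded_by fb => t; have /andP[h0 h1] := oc_ind_itv x y t.
by rewrite ger0_norm ?mulr_ge0// ler_piMr.
Qed.

Let J x y := (\int[mu]_(t in `]x, y]%classic) (f t)%:E)%E.

Let mfE (D : set R) : measurable_fun D (EFin \o f).
Proof. by apply: measurable_funTS; apply/measurable_EFinP. Qed.

Let f_near x y t : - M <= x -> y <= M -> x < t -> t <= y ->
  f y - K * (y - x) <= f t <= f y + K * (y - x).
Proof.
move=> Mx yM xt ty.
have tM : `|t| <= M by rewrite ler_norml (le_trans Mx (ltW xt)) (le_trans ty).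
have yM' : `|y| <= M.
  by rewrite ler_norml yM (le_trans Mx)// (le_trans (ltW xt)).
have yt : 0 <= y - t by rewrite subr_ge0.
have := f_lip tM yM'; rewrite [`|t - y|]distrC (ger0_norm yt) => h.
have k : K * (y - t) <= K * (y - x) by rewrite ler_wpM2l//; lra.
by move: (le_trans h k); rewrite ler_norml; lra.
Qed.

Let Lim_local x y : - M <= x -> x <= y -> y <= M ->
  (f y - K * (y - x)) * nu x y <= Lim (fi x y) <= (f y + K * (y - x)) * nu x y.
Proof.
move=> Mx xy yM; have ib := oc_ind_bounded x y.
have b1 c : ev_bounded (E^~ (fun t => c * oc_ind x y t)).
  have [C [N hC]] := ib; exists (`|c| * C), N => n Nn.
  by rewrite quadZ normrM ler_wpM2l ?hC.
rewrite -!LimZ//; apply/andP; split; apply: Lim_le => // t;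
  rewrite /fi /oc_ind; have [/andP[xt ty]|_] := boolP (x < t <= y);
  rewrite ?mulr0// ?mulr1; by have /andP[] := f_near Mx yM xt ty.
Qed.

Let J_local x y : - M <= x -> x <= y -> y <= M ->
  (((f y - K * (y - x)) * nu x y)%:E <= J x y /\
   J x y <= ((f y + K * (y - x)) * nu x y)%:E)%E.
Proof.
move=> Mx xy yM; have nu0 := nu_ge0 x y.
have Kxy : 0 <= K * (y - x) by rewrite mulr_ge0// subr_ge0.
have mI : measurable (`]x, y]%classic : set R) by exact: measurable_itv.
split.
  (* Comparison of integrals is used for nonnegative functions, so a nonpositive lower constant is
     treated apart. *)
  have [neg|pos] := leP (f y - K * (y - x)) 0.
    apply: (@le_trans _ _ 0%E); last first.
      by apply: integral_ge0 => t _; rewrite lee_fin.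
    by rewrite lee_fin mulr_le0_ge0.
  rewrite EFinM -mu_itv// -integral_cst//; apply: ge0_le_integral => //.
  - by move=> t _; rewrite lee_fin ltW.
  - move=> t /=; rewrite in_itv/= => /andP[xt ty]; rewrite lee_fin.
    by have /andP[] := f_near Mx yM xt ty.
rewrite EFinM -mu_itv// -integral_cst//; apply: ge0_le_integral => //.
- by move=> t _; rewrite lee_fin.
- move=> t /=; rewrite in_itv/= => /andP[xt ty]; rewrite lee_fin.
  by have /andP[] := f_near Mx yM xt ty.
Qed.

Let J_fin x y : - M <= x -> x <= y -> y <= M -> J x y \is a fin_num.
Proof.
move=> Mx xy yM; have [_ h] := J_local Mx xy yM.
rewrite ge0_fin_numE ?(le_lt_trans h) ?ltry//.
by apply: integral_ge0 => t _; rewrite lee_fin.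
Qed.

(** Both sides are additive in the interval and lie within [K * (y - x) * nu x y] of [f y * nu x y]
    on []x, y]]. As [nu x y <= C * (y - x)], they differ by a quadratic term, and bisection
    concludes. *)
Lemma integral_Lim_local : J (- M) M = (Lim (fi (- M) M))%:E.
Proof.
have M0' := M0; have [C C0 hC] := nu_lipschitz M0.
have JD x y z : - M <= x -> x <= y -> y <= z -> z <= M ->
    fine (J x z) = fine (J x y) + fine (J y z).
  move=> Mx xy yz zM; have yM := le_trans yz zM; have My := le_trans Mx xy.
  rewrite -fineD ?J_fin//; congr fine; rewrite /J -ge0_integral_setU//.
  - by rewrite -itv_bndbnd_setU ?bnd_simp.
  - by move=> t _; rewrite lee_fin.
  - apply/disj_setPS => t [] /=; rewrite !in_itv/= => /andP[_ ty] /andP[yt _].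
    by move: (le_lt_trans ty yt); rewrite ltxx.
have LimiD x y z : x <= y -> y <= z ->
    Lim (fi x z) = Lim (fi x y) + Lim (fi y z).
  move=> xy yz; rewrite -LimD//; congr Lim; apply/funext => t.
  by rewrite /fi (oc_ind_split _ xy yz) mulrDr.
have MM : - M <= M by lra.
rewrite -[LHS]fineK ?J_fin//; congr EFin; apply/eqP.
rewrite -subr_eq0 -normr_le0.
apply: (subadditive_quadratic_le0 (g := fun x y => `|fine (J x y) - Lim (fi x y)|)
  (A := 2 * K * C) (l := - M) (r := M)) => //.
  move=> x y z Mx xy yz zM; rewrite (JD x y z)// (LimiD x y z)//.
  by rewrite opprD addrACA ler_normD.
move=> x y Mx xy yM.
have /andP[l1 l2] := Lim_local Mx xy yM.
have [] := J_local Mx xy yM; rewrite -(fineK (J_fin Mx xy yM)) !lee_fin => j1 j2.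
have nC := hC x y Mx xy yM; have nu0 := nu_ge0 x y.
have Kxy : 0 <= K * (y - x) by rewrite mulr_ge0// subr_ge0.
have := ler_wpM2l Kxy nC; rewrite ler_norml => h.
by apply/andP; split; lra.
Qed.

End local_integral.

(** * Tail control and orthonormality of the limit measure *)

Lemma orthopoly_lipschitz (M : R) k : 0 <= M -> exists A K : R,
  [/\ 0 <= A, 0 <= K & forall x y : R, `|x| <= M -> `|y| <= M ->
    `|p k x| <= A /\ `|p k x - p k y| <= K * `|x - y|].
Proof.
move=> M0; have [W W0 wW] := wsol_bound b_nd b_gt0 B0 B1 b_oo M0.
have [C C0 wC] := wsol_lipschitz b_nd b_gt0 B0 B1 b_oo M0.
have sb := sqrt_b_gt0 b_gt0 k.
have pE x : p k x = wsol b B k.+1 x / Num.sqrt (b k).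
  by rewrite /wsol mulrAC divff ?mul1r// lt0r_neq0.
have sk := inv_sum_ge0 b_gt0 k.+1.
exists (W / Num.sqrt (b k)), (C * (1 + inv_sum b k.+1) / Num.sqrt (b k)).
split; [by rewrite divr_ge0 ?ltW| |].
  by rewrite divr_ge0 ?(ltW sb)// mulr_ge0 ?(ltW C0)//; lra.
move=> x y xM yM; rewrite !pE -mulrBl ![`|_ / _|]normrM normfV (gtr0_norm sb); split.
  by rewrite ler_wpM2r ?invr_ge0 ?(ltW sb)//; exact: wW.
rewrite [leRHS]mulrAC ler_wpM2r ?invr_ge0 ?(ltW sb)//.
by rewrite [leRHS]mulrAC; exact: wC.
Qed.

Lemma quad_ortho_pair n j : (j < n)%N ->
  E n (fun x => (ortho_pair a b j x).1 ^+ 2) <= 1.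
Proof.
case: j => [|j] jn.
  rewrite (_ : (fun x => _) = fun=> 0) ?quad_cst//.
  by apply/funext => x; rewrite /= expr0n.
rewrite (_ : (fun x => _) = fun x => p j x * p j x).
  by rewrite quad_orth ?eqxx// ltnW.
by apply/funext => x; rewrite ortho_pair1 expr2.
Qed.

(** The recurrence writes [x * p j x] as a sum of three terms of bounded quadrature norm. The bound
    is independent of [n] and prevents mass of [p j ^+ 2] from escaping to infinity. *)
Lemma quad_moment j : exists2 T : R, 0 <= T & forall n, (j.+1 < n)%N ->
  E n (fun x => x ^+ 2 * p j x ^+ 2) <= T.
Proof.
have [a1 a0] := (sqr_ge0 (a j.+1), sqr_ge0 (a j)).
have b0 := sqr_ge0 (b j).
exists (3 * a j.+1 ^+ 2 + 3 * b j ^+ 2 + 3 * a j ^+ 2); first lra.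
move=> n jn; have jn' := ltnW jn.
apply: (@le_trans _ _ (E n (fun x => 3 * a j.+1 ^+ 2 * (p j.+1 x * p j.+1 x) +
    3 * b j ^+ 2 * (p j x * p j x) +
    3 * a j ^+ 2 * (ortho_pair a b j x).1 ^+ 2))).
  apply: quad_le => x.
  have -> : x ^+ 2 * p j x ^+ 2 =
      (a j.+1 * p j.+1 x + b j * p j x + a j * (ortho_pair a b j x).1) ^+ 2.
    rewrite orthopolyS -exprMn; congr (_ ^+ 2).
    by field; rewrite lt0r_neq0// offdiag_gt0.
  have := sqr_ge0 (a j.+1 * p j.+1 x - b j * p j x).
  have := sqr_ge0 (a j.+1 * p j.+1 x - a j * (ortho_pair a b j x).1).
  have := sqr_ge0 (b j * p j x - a j * (ortho_pair a b j x).1).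
  by move: (p j.+1 x) (p j x) (ortho_pair a b j x).1 => u v t; lra.
rewrite !quadD !quadZ !quad_orth// !eqxx !mulr1.
have := quad_ortho_pair jn' => h.
have := ler_wpM2l a0 h; lra.
Qed.

(** Squares keep every integrand nonnegative. Truncation to []-M, M]] gives the upper bound by
    monotone convergence, and the moment bound [T / M ^+ 2] on the tail gives the lower one. *)
Lemma integral_square j k : (\int[mu]_x ((p j x + p k x) ^+ 2)%:E)%E =
  (2 + 2 * (j == k)%:R)%:E.
Proof.
set h := fun x => (p j x + p k x) ^+ 2; set S : R := 2 + _.
have hE n : ((j + k).+1 <= n)%N -> E n h = S.
  move=> jkn; have jn : (j < n)%N by rewrite (leq_trans _ jkn)// ltnS leq_addr.
  have kn : (k < n)%N by rewrite (leq_trans _ jkn)// ltnS leq_addl.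
  rewrite (_ : h = fun x => p j x * p j x + p k x * p k x + 2 * (p j x * p k x)).
    by rewrite !quadD quadZ !quad_orth// !eqxx.
  by apply/funext => x; rewrite /h; ring.
have hb : ev_bounded (E^~ h) by exists `|S|, (j + k).+1 => n /hE ->.
have h0 x : 0 <= h x by rewrite sqr_ge0.
have mh : measurable_fun setT h.
  by apply: measurable_funX; apply: measurable_funD; exact: measurable_orthopoly.
have LimS : Lim h = S by apply: L_ev_cst hE.
have [T1 T10 hT1] := quad_moment j; have [T2 T20 hT2] := quad_moment k.
pose T := 2 * T1 + 2 * T2.
have T0 : 0 <= T by rewrite /T; lra.
have hib (M : R) : ev_bounded (E^~ (fun t => h t * oc_ind (- M) M t)).
  apply: quad_bounded_by hb => t; have /andP[i0 i1] := oc_ind_itv (- M) M t.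
  by rewrite (ger0_norm (mulr_ge0 (h0 t) i0)) ler_piMr.
have upper (M : R) : Lim (fun t => h t * oc_ind (- M) M t) <= S.
  rewrite -LimS; apply: (Lim_le (hib M) hb) => t.
  by have /andP[i0 i1] := oc_ind_itv (- M) M t; rewrite ler_piMr.
have lower (M : R) : 0 < M -> S <= Lim (fun t => h t * oc_ind (- M) M t) + T / M ^+ 2.
  move=> M0; have M2 : 0 < M ^+ 2 by rewrite exprn_gt0.
  have cb : ev_bounded (fun=> T / M ^+ 2) by exists `|T / M ^+ 2|, 0.
  rewrite -LimS -[X in _ + X]L_cst -LD//.
  apply: (L_le (N := (j + k).+2)) => //.
    have [C1 [N1 hC1]] := hib M; exists (C1 + `|T / M ^+ 2|), N1 => n Nn.
    by rewrite (le_trans (ler_normD _ _))// lerD2r hC1.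
  move=> n jkn; have jn : (j.+1 < n)%N.
    by rewrite (leq_trans _ jkn)// !ltnS leq_addr.
  have kn : (k.+1 < n)%N by rewrite (leq_trans _ jkn)// !ltnS leq_addl.
  apply: (@le_trans _ _ (E n (fun t => h t * oc_ind (- M) M t +
      (M ^+ 2)^-1 * (2 * (t ^+ 2 * p j t ^+ 2) + 2 * (t ^+ 2 * p k t ^+ 2))))).
    apply: quad_le => t.
    have sq : t ^+ 2 * h t <= 2 * (t ^+ 2 * p j t ^+ 2) + 2 * (t ^+ 2 * p k t ^+ 2).
      have := mulr_ge0 (sqr_ge0 t) (sqr_ge0 (p j t - p k t)); rewrite /h; lra.
    have q0 : 0 <= (M ^+ 2)^-1 by rewrite invr_ge0 ltW.
    apply: (@le_trans _ _ (h t * oc_ind (- M) M t + (M ^+ 2)^-1 * (t ^+ 2 * h t)));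
      last by rewrite lerD2l ler_wpM2l.
    rewrite /oc_ind; have [_|out] := boolP (- M < t <= M).
      by rewrite mulr1 lerDl mulr_ge0// mulr_ge0 ?sqr_ge0.
    (* Outside the window [M ^+ 2 <= t ^+ 2], so [h t] is at most [t ^+ 2 * h t / M ^+ 2]. *)
    rewrite mulr0 add0r mulrA ler_peMl// mulrC ler_pdivlMr// mul1r.
    rewrite -[t ^+ 2]real_normK ?num_real// lerXn2r ?nnegrE ?(ltW M0)//.
    rewrite leNgt; apply: contra out => /ltr_normlP[t1 t2].
    by apply/andP; split; lra.
  rewrite quadD lerD2l quadZ quadD !quadZ mulrC ler_wpM2r ?invr_ge0 ?(ltW M2)//.
  by have := hT1 n jn; have := hT2 n kn; rewrite /T; lra.
pose I (M : R) : set R := `]- M, M]%classic.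
have loc (M : R) : 0 <= M -> (\int[mu]_(t in I M) (h t)%:E)%E =
    (Lim (fun t => h t * oc_ind (- M) M t))%:E.
  move=> M0; have [A1 [K1 [A10 K10 h1]]] := orthopoly_lipschitz j M0.
  have [A2 [K2 [A20 K20 h2]]] := orthopoly_lipschitz k M0.
  apply: (@integral_Lim_local h M ((K1 + K2) * (2 * (A1 + A2)))) => //.
    by rewrite mulr_ge0//; lra.
  move=> x y xM yM; have [p1 d1] := h1 x y xM yM; have [p2 d2] := h2 x y xM yM.
  have [p1' _] := h1 y x yM xM; have [p2' _] := h2 y x yM xM.
  have -> : h x - h y = ((p j x - p j y) + (p k x - p k y)) *
      ((p j x + p k x) + (p j y + p k y)) by rewrite /h; ring.
  rewrite normrM mulrAC ler_pM//.
    by rewrite (le_trans (ler_normD _ _))// mulrDl lerD.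
  do 3?[rewrite (le_trans (ler_normD _ _))//].
  have := ler_normD (p j x) (p k x); have := ler_normD (p j y) (p k y); lra.
apply/eqP; rewrite eq_le; apply/andP; split.
  have cv : (\int[mu]_(x in I i%:R%R) (h x)%:E @[i --> \oo] -->
      \int[mu]_(x in \bigcup_i I i%:R%R) (h x)%:E)%E.
    apply: ge0_nondecreasing_set_cvg_integral.
    - move=> m n mn; apply/subsetPset => x; rewrite /I /= !in_itv/=.
      have mn' : m%:R <= n%:R :> R by rewrite ler_nat.
      by move=> /andP[u v]; apply/andP; split; lra.
    - by move=> i; exact: measurable_itv.
    - by move=> i; apply: measurable_funTS; apply/measurable_EFinP.
    - by move=> i x _; rewrite lee_fin.
  rewrite bigcup_itvT in cv; rewrite -(cvg_lim _ cv)//.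
  apply: lime_le; first by apply/cvg_ex; eexists; exact: cv.
  by apply: nearW => i; rewrite loc// lee_fin.
apply/lee_addgt0Pr => e e0.
(* Then [T <= e * M <= e * M ^+ 2], so the tail term is at most [e]. *)
set M := T / e + 1; have M1 : 1 <= M by rewrite /M lerDr divr_ge0// ltW.
have M0 : 0 < M by lra.
have le1 : (S%:E <= (\int[mu]_(t in I M) (h t)%:E) + e%:E)%E.
  rewrite loc ?(ltW M0)// -EFinD lee_fin (le_trans (lower M M0))// lerD2l.
  rewrite ler_pdivrMr ?exprn_gt0//.
  have eM : T <= e * M by rewrite /M mulrDr mulr1 mulrCA divff ?lt0r_neq0//; lra.
  by rewrite (le_trans eM)// ler_wpM2l ?(ltW e0)// expr2; nra.
apply: le_trans le1 _; rewrite leeD2r//; apply: ge0_subset_integral => //.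
- exact: measurable_itv.
- by apply/measurable_EFinP.
- by move=> x _; rewrite lee_fin.
Qed.

Lemma limit_measure_orthonormal : orthonormal_measure a b mu.
Proof.
move=> j k.
have I m n : mu.-integrable setT (fun x => ((p m x + p n x) ^+ 2)%:E).
  apply/integrableP; split.
    apply/measurable_EFinP; apply: measurable_funX; apply: measurable_funD;
      exact: measurable_orthopoly.
  under eq_integral do rewrite gee0_abs ?lee_fin ?sqr_ge0//.
  by rewrite integral_square ltry.
(* Polarisation in terms of squares of the form [(p m + p n) ^+ 2] alone; the weight [8^-1] appears
   because [(p j + p j) ^+ 2 = 4 * p j ^+ 2]. *)
have pE x : (p j x * p k x)%:E = ((2^-1)%:E * ((p j x + p k x) ^+ 2)%:E -
   ((8^-1)%:E * ((p j x + p j x) ^+ 2)%:E + (8^-1)%:E * ((p k x + p k x) ^+ 2)%:E))%E.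
  by rewrite -!EFinM -!(EFinD, EFinN); congr EFin; field.
have IZ m n c : mu.-integrable setT (fun x => c%:E * ((p m x + p n x) ^+ 2)%:E)%E.
  exact: integrableZl.
split.
  under eq_fun do rewrite pE.
  by apply: integrableB => //; apply: integrableD.
under eq_integral do rewrite pE.
rewrite integralB//; last exact: integrableD.
rewrite integralD// !integralZl// !integral_square !eqxx -!EFinM -!(EFinD, EFinN).
by congr EFin; case: (j == k) => /=; field.
Qed.

End limit_measure.

Lemma jacobi_measure_exists (R : realType) (b : nat -> R) (B : R) :
  (forall n, b n <= b n.+1) -> (forall n, 0 < b n) -> 0 < B -> B < 1 ->
  b @ \oo --> +oo -> inv_sum b @ \oo --> +oo ->
  exists mu : {measure set R -> \bar R},
    orthonormal_measure (jacobi_offdiag B b) b mu.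
Proof.
move=> b_nd b_gt0 B0 B1 b_oo s_oo.
have a0 n : jacobi_offdiag B b n != 0 by rewrite lt0r_neq0// offdiag_gt0.
have /choice[q hq] := gauss_quadrature b a0.
have [L [L_le LD LZ L_cst]] := generalized_limit_exists R.
have q_ge0 n z : z \in q n -> 0 <= z.2 by exact: (hq n).1.
have q_orth n := (hq n).2.
have [mu mu_itv] := stieltjes_measure_exists
  (limit_cdf_nd q_ge0 q_orth L_le LD L_cst)
  (limit_cdf_right_continuous b_nd b_gt0 B0 B1 b_oo s_oo q_ge0 q_orth L_le LD L_cst).
exists mu; apply: (limit_measure_orthonormal b_nd b_gt0 B0 B1 b_oo s_oo
  q_ge0 q_orth L_le LD LZ L_cst) => x y xy.
by rewrite mu_itv// (limit_cdfB q_ge0 q_orth LD).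
Qed.

(** The spectral measure is among the measures that make the [p_n] orthonormal. Absolute continuity
    is claimed for all of these, and the existence clause makes that claim non-vacuous. *)
Theorem theorem3p1 (R : realType) (b : nat -> R) (B : R) :
  ((forall n, b n <= b n.+1) \/ (forall n, b n.+1 <= b n)) ->
  (forall n, 0 < b n) ->
  b @ \oo --> +oo ->
  (fun n => b n.+1 / b n) @ \oo --> (1 : R) ->
  (fun N => \sum_(0 <= k < N) (b k)^-1) @ \oo --> +oo ->
  0 < B -> B < 1 ->
  let a := jacobi_offdiag B b in
  (exists mu : {measure set R -> \bar R}, orthonormal_measure a b mu) /\
  (forall mu : {measure set R -> \bar R},
      orthonormal_measure a b mu -> mu `<< (@lebesgue_measure R)) /\
  (forall lo hi : R, exists C : R, forall (n : nat) (x : R),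
      lo <= x <= hi -> (orthopoly a b n x) ^+ 2 <= C / b n).
Proof.
move=> mono b_gt0 b_oo _ s_oo B0 B1 a.
have b_nd n : b n <= b n.+1.
  (* A nonincreasing [b] would stay below [b 0], against its divergence. *)
  case: mono => // b_dec; have [N hN] := b_large b_oo (b 0 + 1).
  have bN m : b m <= b 0 by elim: m => // m; apply: le_trans.
  by have := bN (0 + N)%N; have := hN 0; lra.
split; first exact: jacobi_measure_exists.
split; first exact: jacobi_absolutely_continuous.
exact: orthopoly_sqr_le.
Qed.
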